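(* Let $n\ge 2$ and let $k$ be a field. Consider the letters $X_1=\{r(\overline{\alpha}) : \alpha\in G\setminus\{1\}\}$, where $G$ is the Coxeter group of type $\mathbf{B}_n$, and the positive braid monoid of type $\mathbf{B}_n$, $B(B_{n+1}^{+})=\langle X_1 \mid r(\overline{\alpha})r(\overline{\beta})=r(\overline{\alpha\beta})\ (\alpha\perp\beta)\rangle$. Then the set of relations $$r(\overline{\alpha})r(\overline{\beta})=r(\overline{\alpha\beta})\quad(\alpha\perp\beta),$$ $$r(\overline{\alpha})r(\overline{\beta\gamma})=r(\overline{\alpha\beta})r(\overline{\gamma})\quad(\alpha\perp\beta\perp\gamma),$$ where $\alpha,\beta,\gamma$ range over $G\setminus\{1\}$, is a Gröbner–Shirshov basis of $B(B_{n+1}^{+})$ with respect to the deg-lex ordering on $X_1^*$.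
   Context: $G$ is the group with generators $s_1,\dots,s_n$ and relations $s_i^2=1$; $s_js_i=s_is_j$ ($j-1>i$); $s_{i+1}s_is_{i+1}=s_is_{i+1}s_i$ ($1\le i\le n-2$); $s_ns_{n-1}s_ns_{n-1}=s_{n-1}s_ns_{n-1}s_n$. Put $s_{ji}=s_js_{j-1}\cdots s_i$ for $j\ge i$ and $s_{j,j+1}=1$. Every $\alpha\in G$ equals a unique word $\overline{\alpha}=s_{1i_1}s_{2i_2}\cdots s_{n-1,i_{n-1}}s_{nj_1}\cdots s_{nj_t}$ with $1\le i_l\le l+1$, $1\le j_1<\cdots<j_t\le n$, $t\ge0$ (its normal form); $|\overline{\alpha}|$ is the number of letters $s_i$ in this word (the Coxeter length of $\alpha$). Write $\alpha\perp\beta$ if $|\overline{\alpha\beta}|=|\overline{\alpha}|+|\overline{\beta}|$; $\alpha\perp\beta\perp\gamma$ means $\alpha\perp\beta$ and $\beta\perp\gamma$. The symbol $r(\overline{\alpha})$ denotes a formal letter indexed by $\overline{\alpha}$. Ordering: let $s_1<\cdots<s_n$. Order $X_1$ by $r(\overline{\alpha})<r(\overline{\beta})$ iff $|\overline{\alpha}|>|\overline{\beta}|$, or $|\overline{\alpha}|=|\overline{\beta}|$ and $\overline{\alpha}$ is lexicographically smaller than $\overline{\beta}$. The deg-lex ordering on $X_1^*$ compares words first by number of letters of $X_1$, then lexicographically. Gröbner–Shirshov bases (over an alphabet $Y$): for a monomial well-ordering on $Y^*$ and nonzero $f\in k\langle Y\rangle$ (free associative algebra with unit), $\bar f$ is the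 largest word occurring in $f$; $f$ is monic if the coefficient of $\bar f$ is 1. For monic $f,g$: if $w=\bar f b=a\bar g$ with $|\bar f|+|\bar g|>|w|$, then $(f,g)_w=fb-ag$ is an (intersection) composition; if $w=\bar f=a\bar g b$, then $(f,g)_w=f-agb$ is an (inclusion) composition. A composition is trivial modulo $(S,w)$ if it equals $\sum\alpha_i a_is_ib_i$ with $\alpha_i\in k$, $a_i,b_i\in Y^*$, $s_i\in S$ and $a_i\overline{s_i}b_i<w$. A set $S$ of monic polynomials is a Gröbner–Shirshov basis in $k\langle Y\rangle$ if all compositions of its elements are trivial. A relation $u=v$ between words is identified with the polynomial $u-v$ (multiplied by $-1$ if needed to be monic; identities $u=u$ are discarded). A set of relations $S$ is a Gröbner–Shirshov basis of a monoid $\langle Y\mid R\rangle$ if $S$ is a Gröbner–Shirshov basis in $k\langle Y\rangle$ and $S$ generates the same two-sided ideal as $R$ (so $S$ presents the same monoid). *)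

(* Defs.v *)
From HB Require Import structures.
From mathcomp Require Import all_boot all_algebra.
From mathcomp Require Import generic_quotient boolp classical_sets.
From mathcomp Require Import finmap monalg.

Set Implicit Arguments.
Unset Strict Implicit.
Unset Printing Implicit Defensive.

Local Open Scope classical_set_scope.

(* A letter of a signed word is (y, true) for the generator y or (y, false)   *)
(* for its formal inverse; relations are pairs of positive words.             *)
Definition positive (Y : Type) (w : seq Y) : seq (Y * bool) :=
  [seq (y, true) | y <- w].

Inductive pres_eq (Y : Type) (R : set (seq Y * seq Y)) :
  seq (Y * bool) -> seq (Y * bool) -> Prop :=
| pres_refl u : pres_eq R u u
| pres_sym u v : pres_eq R u v -> pres_eq R v u
| pres_trans u v w : pres_eq R u v -> pres_eq R v w -> pres_eq R u w
| pres_cancel a c y b : pres_eq R (a ++ (y, b) :: (y, ~~ b) :: c) (a ++ c)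
| pres_rel a c u v : R (u, v) ->
    pres_eq R (a ++ positive u ++ c) (a ++ positive v ++ c).

Section PresentedGroup.
Context (Y : choiceType) (R : set (seq Y * seq Y)).
Implicit Types u v w : seq (Y * bool).

Definition pres_eqb u v : bool := `[< pres_eq R u v >].

Fact pres_eqb_refl : reflexive pres_eqb.
Proof. by move=> u; apply/asboolP; apply: pres_refl. Qed.

Fact pres_eqb_sym : symmetric pres_eqb.
Proof. by move=> u v; apply/asboolP/asboolP; apply: pres_sym. Qed.

Fact pres_eqb_trans : transitive pres_eqb.
Proof.
move=> v u w /asboolP uv /asboolP vw; apply/asboolP; exact: pres_trans uv vw.
Qed.

Canonical pres_equiv :=
  EquivRel pres_eqb pres_eqb_refl pres_eqb_sym pres_eqb_trans.

Definition pres_group := {eq_quot pres_equiv}%qT.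
HB.instance Definition _ := Choice.on pres_group.

Definition pres_class u : pres_group := \pi_({eq_quot pres_equiv})%qT u.
Definition pres_repr (x : pres_group) : seq (Y * bool) :=
  @repr _ {eq_quot pres_equiv}%qT x.

Lemma pres_reprK x : pres_class (pres_repr x) = x.
Proof. exact: reprK. Qed.

Lemma pres_classE u v : pres_class u = pres_class v <-> pres_eq R u v.
Proof.
split=> [/eqmodP/asboolP //|uv].
by apply/eqmodP/asboolP.
Qed.

Lemma pres_class_repr u : pres_eq R (pres_repr (pres_class u)) u.
Proof. by apply/pres_classE; rewrite pres_reprK. Qed.

Lemma pres_eq_ctx a c u v :
  pres_eq R u v -> pres_eq R (a ++ u ++ c) (a ++ v ++ c).
Proof.
elim=> {u v} [u|u v _|u v w _ uv _ vw|b d y e|b d u v uv].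
- exact: pres_refl.
- exact: pres_sym.
- exact: pres_trans uv vw.
- by rewrite -!catA !cat_cons !(catA a); apply: pres_cancel.
- by rewrite -!catA !(catA a b); apply: pres_rel.
Qed.

Lemma pres_eq_cat u u' v v' :
  pres_eq R u u' -> pres_eq R v v' -> pres_eq R (u ++ v) (u' ++ v').
Proof.
move=> uu' vv'; apply: pres_trans (pres_eq_ctx [::] v uu') _ => /=.
by have := pres_eq_ctx u' [::] vv'; rewrite !cats0.
Qed.

Definition word_inv w : seq (Y * bool) := rev [seq (x.1, ~~ x.2) | x <- w].

Lemma word_inv_cat u v : word_inv (u ++ v) = word_inv v ++ word_inv u.
Proof. by rewrite /word_inv map_cat rev_cat. Qed.

Lemma word_invK : involutive word_inv.
Proof.
move=> w; rewrite /word_inv map_rev revK -map_comp.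
by apply: map_id_in => -[y b] _ /=; rewrite negbK.
Qed.

Lemma pres_mulV w : pres_eq R (w ++ word_inv w) [::].
Proof.
elim: w => [|[y b] w IHw]; first exact: pres_refl.
rewrite -cat1s word_inv_cat -catA (catA w).
apply: pres_trans (pres_eq_ctx _ _ IHw) _.
exact: (pres_cancel R [::] [::]).
Qed.

Lemma pres_Vmul w : pres_eq R (word_inv w ++ w) [::].
Proof. by have := pres_mulV (word_inv w); rewrite word_invK. Qed.

Lemma pres_eq_inv u v :
  pres_eq R u v -> pres_eq R (word_inv u) (word_inv v).
Proof.
move=> uv; have := pres_eq_ctx (word_inv u) (word_inv v) (pres_sym uv).
move=> h; apply: pres_trans (pres_trans h _).
  rewrite -[X in pres_eq R X _]cats0.
  exact: pres_eq_cat (pres_refl _ _) (pres_sym (pres_mulV v)).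
rewrite catA -[X in pres_eq R _ X]cat0s.
exact: pres_eq_cat (pres_Vmul u) (pres_refl _ _).
Qed.

Definition pres_one : pres_group := pres_class [::].
Definition pres_mul (x y : pres_group) : pres_group :=
  pres_class (pres_repr x ++ pres_repr y).
Definition pres_inv (x : pres_group) : pres_group :=
  pres_class (word_inv (pres_repr x)).

Lemma pres_mulE u v :
  pres_mul (pres_class u) (pres_class v) = pres_class (u ++ v).
Proof. by apply/pres_classE; apply: pres_eq_cat; apply: pres_class_repr. Qed.

Lemma pres_invE u : pres_inv (pres_class u) = pres_class (word_inv u).
Proof. by apply/pres_classE; apply/pres_eq_inv/pres_class_repr. Qed.

Fact pres_mulA : associative pres_mul.
Proof.
move=> x y z; rewrite -[x]pres_reprK -[y]pres_reprK -[z]pres_reprK.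
by rewrite !pres_mulE catA.
Qed.

Fact pres_mul1g : left_id pres_one pres_mul.
Proof. by move=> x; rewrite -[x]pres_reprK pres_mulE. Qed.

Fact pres_mulg1 : right_id pres_one pres_mul.
Proof. by move=> x; rewrite -[x]pres_reprK pres_mulE cats0. Qed.

Fact pres_mulVg : left_inverse pres_one pres_inv pres_mul.
Proof.
move=> x; rewrite -[x]pres_reprK pres_invE pres_mulE.
by apply/pres_classE/pres_Vmul.
Qed.

Fact pres_mulgV : right_inverse pres_one pres_inv pres_mul.
Proof.
move=> x; rewrite -[x]pres_reprK pres_invE pres_mulE.
by apply/pres_classE/pres_mulV.
Qed.

HB.instance Definition _ := isGroup.Build pres_group
  pres_mulA pres_mul1g pres_mulg1 pres_mulVg pres_mulgV.

End PresentedGroup.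

Section CoxeterB.
Context (n : nat).

(* The ordinal i : 'I_n (with 0 <= i < n) stands for the generator s_(i+1).   *)
Inductive coxB_rel : seq 'I_n * seq 'I_n -> Prop :=
| coxB_square (i : 'I_n) : coxB_rel ([:: i; i], [::])
| coxB_comm (i j : 'I_n) : i.+1 < j -> coxB_rel ([:: j; i], [:: i; j])
| coxB_braid3 (i j : 'I_n) : i.+1 = j -> j.+1 < n ->
    coxB_rel ([:: j; i; j], [:: i; j; i])
| coxB_braid4 (i j : 'I_n) : i.+1 = j -> j.+1 = n ->
    coxB_rel ([:: j; i; j; i], [:: i; j; i; j]).

Definition coxB : groupType := pres_group coxB_rel.

Definition coxB_gen (i : 'I_n) : coxB := pres_class coxB_rel [:: (i, true)].

Definition coxB_word (w : seq 'I_n) : coxB := (\prod_(i <- w) coxB_gen i)%g.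

(* Indices of s_j s_(j-1) ... s_i, counted from 1; empty when i = j + 1.      *)
Definition descent (j i : nat) : seq nat := rev (iota i (j.+1 - i)).

Definition is_normal_word (w : seq 'I_n) : Prop :=
  exists (i : nat -> nat) (js : seq nat),
    [/\ forall l, 1 <= l <= n.-1 -> 1 <= i l <= l.+1,
        sorted ltn js,
        all (fun j => 1 <= j <= n) js
      & [seq (nat_of_ord x).+1 | x <- w] =
          flatten [seq descent l (i l) | l <- iota 1 n.-1]
          ++ flatten [seq descent n j | j <- js]].

(* Every element has exactly one normal word, so the default is never used.   *)
Definition normal_form (a : coxB) : seq 'I_n :=
  xget [::] [set w | is_normal_word w /\ coxB_word w = a].

Definition coxB_length (a : coxB) : nat := size (normal_form a).

Definition perp (a b : coxB) : Prop :=
  coxB_length (a * b)%g = coxB_length a + coxB_length b.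

End CoxeterB.

Fixpoint lexlt (T : eqType) (lt : rel T) (u v : seq T) : bool :=
  match u, v with
  | x :: u', y :: v' => lt x y || (x == y) && lexlt lt u' v'
  | [::], _ :: _ => true
  | _, [::] => false
  end.

Definition deglex (Y : choiceType) (lt : rel Y) : rel {fmonom Y} := fun u v =>
  (size u < size v) || (size u == size v) && lexlt lt u v.

Section GroebnerShirshov.
Local Open Scope ring_scope.
Context (k : fieldType) (Y : choiceType) (lt : rel {fmonom Y}).
Local Notation word := {fmonom Y}.
Local Notation alg := {malg k[word]}.
Local Notation "u ** v" := (mmul u v) (at level 40, left associativity).

Definition monomial_well_order : Prop :=
  [/\ irreflexive lt,
      transitive lt,
      (forall u v : word, u != v -> lt u v || lt v u),
      (forall a b u v : word, lt u v -> lt (a ** u ** b) (a ** v ** b))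
    & well_founded lt].

Definition is_leading (f : alg) (w : word) : Prop :=
  w \in msupp f /\ forall u, u \in msupp f -> u = w \/ lt u w.

Definition is_monic (f : alg) : Prop :=
  exists2 w, is_leading f w & f@_w = 1.

Definition trivial_modulo (S : set alg) (w : word) (f : alg) : Prop :=
  exists (m : nat) (c : 'I_m -> k) (a b : 'I_m -> word) (s : 'I_m -> alg),
    (forall i, S (s i) /\
       exists2 v, is_leading (s i) v & lt (a i ** v ** b i) w) /\
    f = \sum_(i < m) c i *: (<< a i >> * s i * << b i >>).

Definition GS_basis (S : set alg) : Prop :=
  (forall f, S f -> is_monic f) /\
  forall f g fbar gbar,
    S f -> S g -> is_leading f fbar -> is_leading g gbar ->
    (forall w a b, w = fbar ** b -> w = a ** gbar ->
       (size w < size fbar + size gbar)%N ->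
       trivial_modulo S w (f * << b >> - << a >> * g)) /\
    (forall w a b, w = fbar -> w = a ** gbar ** b ->
       trivial_modulo S w (f - << a >> * g * << b >>)).

Definition rel_polys (R : set (word * word)) : set alg :=
  [set p | exists u v, [/\ R (u, v), u != v &
     p = if lt v u then << u >> - << v >> else << v >> - << u >>]].

Definition ideal_gen (S : set alg) : set alg :=
  [set f | exists (m : nat) (a b s : 'I_m -> alg),
     (forall i, S (s i)) /\ f = \sum_(i < m) a i * s i * b i].

(* A Groebner-Shirshov basis is relative to a monomial well-ordering, hence   *)
(* the first conjunct; two relation sets present the same monoid exactly when *)
(* their polynomials generate the same two-sided ideal.                       *)
Definition GS_basis_of_monoid (R S : set (word * word)) : Prop :=
  [/\ monomial_well_order,
      GS_basis (rel_polys S)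
    & ideal_gen (rel_polys S) = ideal_gen (rel_polys R)].

End GroebnerShirshov.

Section BraidMonoidB.
Context (n : nat).

(* The letter r(a) is encoded by the group element a <> 1 rather than by its  *)
(* normal form, which determines it.                                          *)
Definition letter : choiceType := {a : coxB n | (a != 1)%g}.

Definition letter_lt : rel letter := fun a b =>
  let u := normal_form (val a) in
  let v := normal_form (val b) in
  (size v < size u) ||
  (size u == size v) && lexlt (fun i j : 'I_n => i < j) u v.

Local Notation r := (@fmu letter).

Definition braidB_rels : set ({fmonom letter} * {fmonom letter}) :=
  [set p | exists a b ab : letter,
     [/\ perp (val a) (val b), val ab = (val a * val b)%g
       & p = (mmul (r a) (r b), r ab)]].

Definition braidB_shift_rels : set ({fmonom letter} * {fmonom letter}) :=
  [set p | exists a b c ab bc : letter,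
     [/\ perp (val a) (val b), perp (val b) (val c),
         val ab = (val a * val b)%g, val bc = (val b * val c)%g
       & p = (mmul (r a) (r bc), mmul (r ab) (r c))]].

End BraidMonoidB.

(* Main.v *)
From Stdlib Require Import Wellfounded.
Require Import Defs.
From mathcomp Require Import all_boot all_order all_algebra all_fingroup.
From mathcomp Require Import boolp classical_sets.
From mathcomp Require Import zify finmap monalg.

(* A composition of two relations is a difference of two words that represent
   the same element, so it is trivial as soon as the two words can be rewritten
   to a common word.  On three letters this is formal: it uses only that the
   length is additive along both relations and that [perp] is associative.  On
   two letters r(a) r(c), two rewritings move prefixes b1 and b2 of c onto a, and
   one needs a common upper bound m of b1 and b2 among the prefixes of c, with a
   perpendicular to m.  This is the join of b1 and b2 in the weak order.

   To get it, let G act by signed permutations, that is, by the permutations of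
   2n points that commute with the reversal.  Normal words are reduced for the
   inversion count of this action, so the normal-form length is the Coxeter
   length, the action is faithful, and a is perpendicular to b exactly when the
   inversions of a^-1 and of b are disjoint.  The join is then the permutation
   whose inversions are the transitive closure of those of b1 and b2. *)

Set Implicit Arguments.
Unset Strict Implicit.
Unset Printing Implicit Defensive.

Import GRing.Theory.

(** * Inversions of signed permutations *)

Section SignedPermutations.
Context (n : nat).
Local Notation I := 'I_(n.*2).
Implicit Types (g h : {perm I}) (x y z : I).
Local Open Scope group_scope.

(** The 2n points are the values -n, ..., -1, 1, ..., n in increasing order and [rev_ord] is the
    change of sign, so this is the hyperoctahedral group. *)
Definition signed_perm g : bool := [forall x, g (rev_ord x) == rev_ord (g x)].

Lemma signed_permP g :
  reflect (forall x, g (rev_ord x) = rev_ord (g x)) (signed_perm g).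
Proof. exact: 'forall_eqP. Qed.

Lemma signed_perm_group_set : group_set [set g | signed_perm g].
Proof.
apply/group_setP; split=> [|g h]; first by rewrite inE; apply/signed_permP=> x; rewrite !perm1.
rewrite !inE => /signed_permP gP /signed_permP hP; apply/signed_permP=> x.
by rewrite !permM gP hP.
Qed.
Canonical signed_perm_group := group signed_perm_group_set.

Lemma signed_permM g h : signed_perm g -> signed_perm h -> signed_perm (g * h).
Proof. by have := @groupM _ signed_perm_group g h; rewrite !inE. Qed.

Lemma signed_permV g : signed_perm g -> signed_perm g^-1.
Proof. by have := @groupV _ signed_perm_group g; rewrite !inE => ->. Qed.

(** As an exclusive or, this is symmetric in the two points, and composition becomes addition modulo
    2; for x < y it is the usual inversion. *)
Definition inverts g x y : bool := (x < y) (+) (g x < g y).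

Lemma invertsM g h x y : inverts (g * h) x y = inverts g x y (+) inverts h (g x) (g y).
Proof. by rewrite /inverts !permM -addbA (addbA (g x < g y)) addbb. Qed.

Lemma invertsV g x y : inverts g^-1 x y = inverts g (g^-1 x) (g^-1 y).
Proof. by rewrite /inverts !permKV addbC. Qed.

Lemma inverts_rev g x y : signed_perm g -> inverts g (rev_ord x) (rev_ord y) = inverts g y x.
Proof.
move/signed_permP=> gP; rewrite /inverts !gP /=.
have lt_rev (u v : I) : (n.*2 - u.+1 < n.*2 - v.+1) = (v < u).
  by have := ltn_ord u; have := ltn_ord v; lia.
by rewrite !lt_rev.
Qed.

Lemma inverts_sym g x y : inverts g x y = inverts g y x.
Proof.
rewrite /inverts; case: (ltngtP x y) => [xy|yx|/val_inj -> //];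
  case: (ltngtP (g x) (g y)) => [|//|/val_inj/perm_inj exy]; by [|subst; lia].
Qed.

(* Fixed points of the orbit map (x, y) -> (-y, -x) count twice, so that every
   reflection contributes exactly 4 to the sum below. *)
Definition pair_weight x y : nat := (y == rev_ord x).+1.

Definition inv_weight g : nat := \sum_x \sum_y pair_weight x y * inverts g x y.

Lemma pair_weight_perm g x y :
  signed_perm g -> pair_weight (g x) (g y) = pair_weight x y.
Proof. by move/signed_permP=> gP; rewrite /pair_weight -gP (inj_eq perm_inj). Qed.

(** The pairs that g inverts and h restores: each is lost twice in the weight of the product. *)
Definition overlap g h : nat :=
  \sum_x \sum_y pair_weight x y * (inverts g x y && inverts h (g x) (g y)).

Lemma inv_weightM g h : signed_perm g ->
  inv_weight (g * h) + (overlap g h).*2 = inv_weight g + inv_weight h.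
Proof.
move=> gP; have -> : inv_weight h =
    \sum_x \sum_y pair_weight x y * inverts h (g x) (g y).
  rewrite /inv_weight (reindex_inj (@perm_inj _ g)) /=.
  apply: eq_bigr => x _; rewrite (reindex_inj (@perm_inj _ g)) /=.
  by apply: eq_bigr => y _; rewrite pair_weight_perm.
rewrite -[(overlap g h).*2]muln2 !big_distrl /= -!big_split; apply: eq_bigr => x _ /=.
rewrite big_distrl /= -!big_split; apply: eq_bigr => y _ /=.
by rewrite invertsM; case: (inverts g x y); case: (inverts h _ _) => /=; lia.
Qed.

Definition reduced_pair g h : Prop :=
  forall x y, inverts g x y -> ~~ inverts h (g x) (g y).

Lemma overlap_eq0 g h : overlap g h = 0 <-> reduced_pair g h.
Proof.
split=> [/eqP|red].
  rewrite sum_nat_eq0 => /forallP ov x y gxy.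
  move: (ov x); rewrite sum_nat_eq0 => /forallP/(_ y).
  by rewrite gxy muln_eq0 /= eqb0.
apply: big1 => x _; apply: big1 => y _.
have := red x y; case: (inverts g x y) => [/(_ isT)/negbTE->|_]; exact: muln0.
Qed.

Lemma inv_weight_perp g h : signed_perm g ->
  inv_weight (g * h) = inv_weight g + inv_weight h <-> reduced_pair g h.
Proof.
move=> gP; rewrite -overlap_eq0; have := inv_weightM h gP; lia.
Qed.

Lemma inv_weight_le g h : signed_perm g ->
  inv_weight (g * h) <= inv_weight g + inv_weight h.
Proof. by move=> gP; rewrite -inv_weightM // leq_addr. Qed.

Lemma inv_weight1 : inv_weight 1 = 0.
Proof.
by apply: big1 => x _; apply: big1 => y _; rewrite /inverts !perm1 addbb muln0.
Qed.

(** Letters decrease as their length grows, so their ordering is well-founded only thanks to this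
    bound. *)
Lemma inv_weight_bounded : exists N, forall g, inv_weight g <= N.
Proof.
exists (\sum_x \sum_y pair_weight x y) => g.
by apply: leq_sum => x _; apply: leq_sum => y _; case: inverts; lia.
Qed.

(** * Coxeter generators as signed adjacent transpositions *)

Definition swap_pos (i p : nat) : nat :=
  if p == i then i.+1 else if p == i.+1 then i else
  if p == n.*2 - i.+1 then n.*2 - i.+2 else
  if p == n.*2 - i.+2 then n.*2 - i.+1 else p.

Lemma swap_pos_lt (i : 'I_n) (x : I) : swap_pos i x < n.*2.
Proof.
by rewrite /swap_pos; do 4?[case: eqP => ?]; have := ltn_ord i;
  have := ltn_ord x; lia.
Qed.

Lemma swap_posK (i : 'I_n) (p : nat) : swap_pos i (swap_pos i p) = p.
Proof.
have := ltn_ord i; rewrite /swap_pos => lt_i.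
by do 4?[case: (p =P _) => ?]; do 4?[case: eqP => ?]; try lia.
Qed.

Definition swap_ord (i : 'I_n) (x : I) : I := Ordinal (swap_pos_lt i x).

Fact swap_ordK i : involutive (swap_ord i).
Proof. by move=> x; apply/val_inj/swap_posK. Qed.

(** For i = n - 1 the two mirrored pairs of positions coincide, and this is the middle
    transposition, a sign change. *)
Definition signed_swap (i : 'I_n) : {perm I} := perm (inv_inj (swap_ordK i)).

Lemma signed_swapE i x : signed_swap i x = swap_pos i x :> nat.
Proof. by rewrite permE. Qed.

Lemma signed_swapP i : signed_perm (signed_swap i).
Proof.
apply/signed_permP=> x; apply/val_inj; rewrite /= !signed_swapE /=.
have := ltn_ord i; have := ltn_ord x; rewrite /swap_pos => lt_x lt_i.
by do 4?[case: (x =P _ :> nat) => ?]; do 4?[case: eqP => ?]; try lia.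
Qed.

Lemma signed_swap_sq i : signed_swap i * signed_swap i = 1.
Proof.
by apply/permP=> x; apply/val_inj; rewrite permM perm1 /= !signed_swapE swap_posK.
Qed.

Lemma signed_swapV i : (signed_swap i)^-1 = signed_swap i.
Proof. by apply: (mulgI (signed_swap i)); rewrite mulgV signed_swap_sq. Qed.

Variant swap_pos_spec (i p : nat) : nat -> Prop :=
| SwapPos1 of p = i : swap_pos_spec i p i.+1
| SwapPos2 of p = i.+1 : swap_pos_spec i p i
| SwapPos3 of p <> i & p <> i.+1 & p = n.*2 - i.+1 :
    swap_pos_spec i p (n.*2 - i.+2)
| SwapPos4 of p <> i & p <> i.+1 & p = n.*2 - i.+2 :
    swap_pos_spec i p (n.*2 - i.+1)
| SwapPos5 of p <> i & p <> i.+1 & p <> n.*2 - i.+1 & p <> n.*2 - i.+2 :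
    swap_pos_spec i p p.

Lemma swap_posP i p : swap_pos_spec i p (swap_pos i p).
Proof.
rewrite /swap_pos; do 4?[case: (p =P _) => ?]; by constructor.
Qed.

Ltac swap_cases := repeat match goal with
  | |- context [swap_pos ?i ?p] =>
    lazymatch p with
    | context [swap_pos] => fail
    | _ => case: (swap_posP i p) => [?|?|? ? ?|? ? ?|? ? ? ?]; try (exfalso; lia)
    end
  end.

Lemma signed_swap_comm (i j : 'I_n) : i.+1 < j ->
  signed_swap j * signed_swap i = signed_swap i * signed_swap j.
Proof.
move=> ij; apply/permP=> x; apply/val_inj; rewrite !permM /= !signed_swapE.
have := ltn_ord i; have := ltn_ord j; have := ltn_ord x => *.
by swap_cases; lia.
Qed.

Lemma signed_swap_braid3 (i j : 'I_n) : i.+1 = j -> j.+1 < n ->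
  signed_swap j * signed_swap i * signed_swap j =
  signed_swap i * signed_swap j * signed_swap i.
Proof.
move=> ij jn; apply/permP=> x; apply/val_inj; rewrite !permM /= !signed_swapE.
have := ltn_ord x; rewrite -ij in jn * => *.
by swap_cases; lia.
Qed.

Lemma signed_swap_braid4 (i j : 'I_n) : i.+1 = j -> j.+1 = n ->
  signed_swap j * signed_swap i * signed_swap j * signed_swap i =
  signed_swap i * signed_swap j * signed_swap i * signed_swap j.
Proof.
move=> ij jn; apply/permP=> x; apply/val_inj; rewrite !permM /= !signed_swapE.
have := ltn_ord x; rewrite -ij in jn * => *.
by swap_cases; lia.
Qed.

Lemma inverts_swap (i : 'I_n) x y : inverts (signed_swap i) x y ->
  [\/ x = i :> nat /\ y = i.+1 :> nat, y = i :> nat /\ x = i.+1 :> nat,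
      x = n.*2 - i.+2 :> nat /\ y = n.*2 - i.+1 :> nat
    | y = n.*2 - i.+2 :> nat /\ x = n.*2 - i.+1 :> nat].
Proof.
have := ltn_ord i; have := ltn_ord x; have := ltn_ord y => lt_y lt_x lt_i.
rewrite /inverts !signed_swapE /=.
by swap_cases; move=> ?; first [ exfalso; lia | apply: Or41; lia | apply: Or42; lia
                    | apply: Or43; lia | apply: Or44; lia].
Qed.

(** In general four ordered pairs of weight 1 are inverted; for the middle transposition, two of
    weight 2. *)
Lemma inv_weight_swap (i : 'I_n) : inv_weight (signed_swap i) = 4.
Proof.
have lt_i := ltn_ord i.
have ltp (p : nat) : p < n.*2 -> \sum_(x : I) (val x == p) = 1%N.
  move=> lt_p; rewrite (bigD1 (Ordinal lt_p)) //= eqxx big1 // => x.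
  by rewrite -val_eqE /= => /negbTE->.
transitivity (\sum_(x : I) ((val x == i) + (val x == i.+1) +
   (val x == n.*2 - i.+1) + (val x == n.*2 - i.+2))); last first.
  by rewrite !big_split /= !ltp; lia.
apply: eq_bigr => x _; rewrite (bigD1 (signed_swap i x)) //= big1 ?addn0.
  rewrite /pair_weight /inverts -val_eqE /= !signed_swapE swap_posK.
  have := ltn_ord x => *.
  by swap_cases; lia.
move=> y; rewrite -val_eqE /= signed_swapE => /eqP nyx.
apply/eqP; rewrite muln_eq0 /= eqb0; apply/negP => inv_xy; move: nyx; have := ltn_ord x.
by case: (inverts_swap inv_xy) => -[? ?] ?; swap_cases; lia.
Qed.

(** The swap inverts only p, q and their mirror images, whose preimages g leaves in order. *)
Lemma inv_weight_swapr g (i : 'I_n) (p q : I) : signed_perm g ->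
    p = i :> nat -> q = i.+1 :> nat -> g^-1 p < g^-1 q ->
  inv_weight (g * signed_swap i) = inv_weight g + 4.
Proof.
move=> gP pi qi pq; rewrite -(inv_weight_swap i); apply/inv_weight_perp => // x y.
have lt_i := ltn_ord i.
have rp z : z = n.*2 - i.+1 :> nat -> z = rev_ord p.
  by move=> zE; apply/val_inj; rewrite /= zE pi.
have rq z : z = n.*2 - i.+2 :> nat -> z = rev_ord q.
  by move=> zE; apply/val_inj; rewrite /= zE qi.
have g_pq : inverts g (g^-1 p) (g^-1 q) = false.
  by rewrite -invertsV /inverts pq pi qi ltnSn.
have gVP := signed_permP _ (signed_permV gP).
apply: contraTN => /inverts_swap inv_xy; rewrite -[x](permK g) -[y](permK g).
case: inv_xy => -[xE yE].
- by rewrite (val_inj (etrans xE (esym pi))) (val_inj (etrans yE (esym qi))) g_pq.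
- rewrite (val_inj (etrans xE (esym pi))) (val_inj (etrans yE (esym qi))).
  by rewrite inverts_sym g_pq.
- by rewrite (rq _ xE) (rp _ yE) !gVP inverts_rev // g_pq.
- by rewrite (rq _ xE) (rp _ yE) !gVP inverts_rev // inverts_sym g_pq.
Qed.

(** Without a descent the inverse is increasing, and the only increasing permutation of a finite
    chain is the identity. *)
Lemma signed_perm_descent g : signed_perm g -> g != 1 ->
  exists (i : 'I_n) (p q : I),
    [/\ p = i :> nat, q = i.+1 :> nat & g^-1 q < g^-1 p].
Proof.
move=> gP; apply: contraNP => nex; have gVP := signed_permP _ (signed_permV gP).
have asc0 (p q : I) : p < n -> q = p.+1 :> nat -> g^-1 p < g^-1 q.
  move=> lt_p qE; rewrite ltnNge leq_eqVlt; apply/norP; split.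
    by apply/eqP => /val_inj/perm_inj eqp; move: qE; rewrite eqp; lia.
  by apply/negP => lt_qp; apply: nex; exists (Ordinal lt_p), p, q.
(* Ascents in the upper half are mirror images of ascents in the lower half. *)
have asc (p q : I) : q = p.+1 :> nat -> g^-1 p < g^-1 q.
  move=> qE; case: (ltnP p n) => [/asc0|le_np]; first exact.
  have := @asc0 (rev_ord q) (rev_ord p); rewrite !gVP /=.
  by have := ltn_ord (g^-1 p); have := ltn_ord (g^-1 q); have := ltn_ord q; lia.
have ge (p : I) : p <= g^-1 p.
  case: p => p; elim: p => //= p IHp lt_p.
  have lt_p' : p < n.*2 by lia.
  by have := IHp lt_p'; have := asc (Ordinal lt_p') (Ordinal lt_p) erefl; lia.
have fix_g (p : I) : g^-1 p = p.
  apply/val_inj => /=; apply/eqP; rewrite eqn_leq ge andbT.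
  have := ge (rev_ord p); rewrite gVP /=.
  by have := ltn_ord (g^-1 p); have := ltn_ord p; lia.
by apply/eqP/permP => x; rewrite perm1 -[x in RHS](permK g) fix_g.
Qed.

(** Removing a descent lowers the weight by 4, so induction on the weight reaches the identity. *)
Lemma signed_perm_gen (P : {perm I} -> Prop) :
    P 1 -> (forall g i, signed_perm g -> P g -> P (g * signed_swap i)) ->
  forall g, signed_perm g -> P g.
Proof.
move=> P1 PM g; have [N leN] := ubnP (inv_weight g).
elim: N => // N IHN in g leN *; move=> gP.
have [-> // | ng1] := eqVneq g 1.
have [i [p [q [pE qE lt_qp]]]] := signed_perm_descent gP ng1.
pose h := g * signed_swap i.
have hP : signed_perm h by apply: signed_permM (signed_swapP i).
have gE : g = h * signed_swap i by rewrite /h -mulgA signed_swap_sq mulg1.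
have hVE (r : I) : h^-1 r = g^-1 (signed_swap i r).
  by rewrite /h invMg signed_swapV permM.
rewrite gE; apply: PM => //; apply: IHN => //.
have : inv_weight (h * signed_swap i) = inv_weight h + 4.
  apply: (inv_weight_swapr hP pE qE); rewrite !hVE.
  have -> : signed_swap i p = q.
    by apply/val_inj; rewrite /= signed_swapE pE qE /swap_pos eqxx.
  have -> // : signed_swap i q = p.
  by apply/val_inj; rewrite /= signed_swapE pE qE /swap_pos ifN ?eqxx //; lia.
by rewrite -gE; move: leN; rewrite -/(inv_weight g); lia.
Qed.

(** Since [c] and its complement are transitive, reversing the natural order exactly on the pairs of
    [c] gives a linear order, and m sends each point to its rank. Invariance under the mirror makes
    m signed. *)
Lemma perm_of_inversions (c : rel I) :
    (forall x y, c x y -> x < y) -> (forall x y z, c x y -> c y z -> c x z) ->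
    (forall x y z, x < y -> y < z -> c x z -> c x y || c y z) ->
    (forall x y, c (rev_ord x) (rev_ord y) = c y x) ->
  exists2 m : {perm I}, signed_perm m &
    forall x y, x < y -> inverts m x y = c x y.
Proof.
move=> c_lt c_tr c_cotr c_rev.
pose o x y := if x < y then ~~ c x y else c y x.
have o_irr x : o x x = false.
  by rewrite /o ltnn; apply/negP => /c_lt; rewrite ltnn.
have c_asym x y : x < y -> c y x = false.
  by move=> lt_xy; apply/negP => /c_lt; lia.
have o_tot x y : x != y -> o x y = ~~ o y x.
  rewrite -val_eqE /o => /= nxy.
  by case: (ltngtP x y) nxy => //= _ _; rewrite negbK.
have o_tr y x z : o x y -> o y z -> o x z.
  have [->|nxy] := eqVneq x y => //.
  have [->|nyz] := eqVneq y z => //.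
  have [->|nxz] := eqVneq x z; first by rewrite (o_tot y z) // => ->.
  move: nxy nyz nxz; rewrite -!val_eqE /= /o.
  have := c_cotr x y z; have := c_cotr x z y; have := c_cotr y x z.
  have := c_cotr y z x; have := c_cotr z x y; have := c_cotr z y x.
  have := c_tr x y z; have := c_tr x z y; have := c_tr y x z.
  have := c_tr y z x; have := c_tr z x y; have := c_tr z y x.
  case: (ltngtP x y) => //; case: (ltngtP y z) => //; case: (ltngtP x z) => //;
  try lia;
  by case: (c x y); case: (c y z); case: (c x z); case: (c y x);
     case: (c z y); case: (c z x); intuition.
have o_rev x y : o (rev_ord x) (rev_ord y) = o y x.
  rewrite /o !c_rev /=; congr (if _ then _ else _).
  by have := ltn_ord x; have := ltn_ord y; lia.
pose rank x := #|[pred y | o y x]|.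
have rank_lt x : rank x < n.*2.
  rewrite -[X in _ < X](card_ord n.*2) /rank.
  by apply: (@proper_card _ _ predT); rewrite properE; apply/andP; split;
    [exact: subset_predT | apply/subsetPn; exists x; rewrite // inE o_irr].
have rank_mono x y : o x y -> rank x < rank y.
  move=> oxy; apply: proper_card; apply/properP; split.
    by apply/fintype.subsetP => z; rewrite !inE => /o_tr/(_ oxy).
  by exists x; rewrite !inE ?o_irr.
have rank_inj : injective (fun x => Ordinal (rank_lt x)).
  move=> x y /(congr1 val) /= eq_r; apply/eqP; apply: contra_eqT eq_r => nxy.
  rewrite neq_ltn; have := o_tot x y nxy.
  have [/rank_mono-> _|_ /rank_mono-> //] := boolP (o y x).
  by rewrite orbT.
have mE x : perm rank_inj x = rank x :> nat by rewrite permE.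
exists (perm rank_inj) => [|x y lt_xy].
  apply/signed_permP => x; apply/val_inj; rewrite /= !mE.
  have -> : rank (rev_ord x) = #|[pred y | o x y]|.
    rewrite /rank -!sum1_card (reindex_inj rev_ord_inj) /=.
    by apply: eq_bigl => y; rewrite !inE o_rev.
  (* The points other than x lie before or after x, so the mirror image of x has rank 2n - 1 -
     [rank x]. *)
  have := cardC [pred y | o y x]; rewrite card_ord (cardD1 x [predC _]).
  have -> : #|[predD1 [predC [pred y | o y x]] & x]| = #|[pred y | o x y]|.
    apply: eq_card => y; rewrite !inE.
    have [->|nyx] /= := eqVneq y x; first by rewrite o_irr.
    by rewrite (o_tot y x) // negbK.
  by rewrite !inE o_irr /rank => cE; rewrite -[X in _ = X - _]cE addnA addn1 addKn.
rewrite /inverts lt_xy !mE /= -[RHS]negbK; congr (~~ _).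
transitivity (o x y); last by rewrite /o lt_xy.
apply/idP/idP => [|/rank_mono //]; apply: contraLR.
rewrite -leqNgt => noxy; apply/ltnW/rank_mono.
by rewrite (o_tot y x) // -val_eqE /= gtn_eqF.
Qed.

End SignedPermutations.

(** * The action of G by signed permutations *)

Section PresentedGroupLift.
Local Open Scope group_scope.
Context (Y : choiceType) (R : set (seq Y * seq Y)) (H : groupType) (f : Y -> H).
Hypothesis fR : forall u v, R (u, v) -> \prod_(y <- u) f y = \prod_(y <- v) f y.

Definition eval_word (w : seq (Y * bool)) : H :=
  \prod_(y <- w) (if y.2 then f y.1 else (f y.1)^-1).

Lemma eval_word_cat u v : eval_word (u ++ v) = eval_word u * eval_word v.
Proof. exact: big_cat. Qed.

Lemma eval_word_eq u v : pres_eq R u v -> eval_word u = eval_word v.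
Proof.
elim=> {u v} [//|u v _ -> //|u v w _ -> _ -> //|a c y b|a c u v Ruv].
  rewrite !eval_word_cat /eval_word !big_cons /=; congr (_ * _).
  rewrite mulgA.
  by case: b; rewrite /= ?mulgV ?mulVg mul1g.
rewrite !eval_word_cat; congr (_ * (_ * _)).
by rewrite /eval_word /positive !big_map /=; apply: fR.
Qed.

(** The homomorphism given by the universal property of the presentation. *)
Definition pres_lift (x : pres_group R) : H := eval_word (pres_repr x).

Lemma pres_liftE u : pres_lift (pres_class R u) = eval_word u.
Proof. exact/eval_word_eq/pres_class_repr. Qed.

Lemma pres_liftM : {morph pres_lift : x y / x * y}.
Proof.
move=> x y; rewrite -[x]pres_reprK -[y]pres_reprK.
rewrite [_ * _]pres_mulE !pres_liftE; exact: eval_word_cat.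
Qed.

Lemma pres_lift1 : pres_lift 1 = 1.
Proof. by rewrite [1]/(pres_class R [::]) pres_liftE /eval_word big_nil. Qed.
End PresentedGroupLift.

Section CoxeterBAction.
Context (n : nat).
Implicit Types (a b c : coxB n) (i j : 'I_n).
Local Open Scope group_scope.

Fact signed_swap_rel u v : coxB_rel (u, v) ->
  \prod_(i <- u) signed_swap i = \prod_(i <- v) @signed_swap n i.
Proof.
move=> Ruv; inversion Ruv as [i|i j ij|i j ij jn|i j ij jn]; subst;
  rewrite !big_cons !big_nil ?mulg1.
- exact: signed_swap_sq.
- exact: signed_swap_comm.
- by rewrite !mulgA signed_swap_braid3.
- by rewrite !mulgA signed_swap_braid4.
Qed.

Definition to_perm (a : coxB n) : {perm 'I_(n.*2)} := pres_lift (@signed_swap n) a.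

Lemma to_permM : {morph to_perm : a b / a * b}.
Proof. exact: (pres_liftM signed_swap_rel). Qed.

Lemma to_perm1 : to_perm 1 = 1.
Proof. exact: (pres_lift1 signed_swap_rel). Qed.

Lemma to_permV : {morph to_perm : a / a^-1}.
Proof. by move=> a; apply: (mulgI (to_perm a)); rewrite -to_permM !mulgV to_perm1. Qed.

Lemma to_perm_gen i : to_perm (coxB_gen i) = signed_swap i.
Proof. by rewrite /to_perm (pres_liftE signed_swap_rel) /eval_word big_seq1. Qed.

Lemma coxB_wordE (w : seq 'I_n) : coxB_word w = pres_class _ (positive w).
Proof.
elim: w => [|i w IHw]; rewrite /coxB_word ?big_nil ?big_cons // -/(coxB_word w) IHw.
exact: pres_mulE.
Qed.

Lemma coxB_word_rel u v : coxB_rel (u, v) -> coxB_word u = @coxB_word n v.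
Proof.
move=> uv; rewrite !coxB_wordE; apply/pres_classE.
by have := pres_rel [::] [::] uv; rewrite /= !cats0.
Qed.

Lemma coxB_gen_sq i : coxB_gen i * coxB_gen i = 1.
Proof.
by have := coxB_word_rel (coxB_square i); rewrite /coxB_word !big_cons big_nil mulg1.
Qed.

Lemma coxB_gen_comm i j : i.+1 < j ->
  coxB_gen j * coxB_gen i = coxB_gen i * coxB_gen j.
Proof.
by move/coxB_comm/coxB_word_rel; rewrite /coxB_word !big_cons !big_nil !mulg1.
Qed.

Lemma coxB_gen_braid3 i j : i.+1 = j -> j.+1 < n ->
  coxB_gen j * coxB_gen i * coxB_gen j = coxB_gen i * coxB_gen j * coxB_gen i.
Proof.
move=> ij /(coxB_braid3 ij)/coxB_word_rel.
by rewrite /coxB_word !big_cons !big_nil !mulg1 !mulgA.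
Qed.

Lemma coxB_gen_braid4 i j : i.+1 = j -> j.+1 = n ->
  coxB_gen j * coxB_gen i * coxB_gen j * coxB_gen i =
  coxB_gen i * coxB_gen j * coxB_gen i * coxB_gen j.
Proof.
move=> ij /(coxB_braid4 ij)/coxB_word_rel.
by rewrite /coxB_word !big_cons !big_nil !mulg1 !mulgA.
Qed.

(** Generators are involutions, so a formal inverse letter denotes the generator itself. *)
Lemma coxB_ind (P : coxB n -> Prop) :
  P 1 -> (forall a i, P a -> P (a * coxB_gen i)) -> forall a, P a.
Proof.
move=> P1 PM a; rewrite -[a]pres_reprK; elim/last_ind: (pres_repr a) => // w [i b] Pw.
have -> : pres_class (@coxB_rel n) (rcons w (i, b)) = pres_class _ w * coxB_gen i.
  rewrite -cats1 -pres_mulE; congr (_ * _).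
  case: b => //; apply: (@mulgI (coxB n) (coxB_gen i)); rewrite coxB_gen_sq.
  by rewrite [LHS]pres_mulE; apply/pres_classE; apply: (pres_cancel _ [::] [::] i true).
exact: PM.
Qed.

Lemma to_perm_signed a : signed_perm (to_perm a).
Proof.
elim/coxB_ind: a => [|a i IHa]; last first.
  by rewrite to_permM to_perm_gen signed_permM // signed_swapP.
by rewrite to_perm1; apply/signed_permP => x; rewrite !perm1.
Qed.

Lemma to_perm_surj g : signed_perm g -> exists a, to_perm a = g.
Proof.
move: g; apply: signed_perm_gen => [|_ i _ [a <-]]; first by exists 1; exact: to_perm1.
by exists (a * coxB_gen i); rewrite to_permM to_perm_gen.
Qed.

End CoxeterBAction.

(** * Existence of normal words *)

Section NormalWords.
Context (n : nat).
Implicit Types (a b c : coxB n) (i j k l m : nat) (js : seq nat).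
Local Open Scope group_scope.

(* [s j] is the generator s_j of the paper, with 1 <= j <= n; out of this range, except for
   [s 0] = s_1, it is 1. *)
Definition s j : coxB n := oapp (@coxB_gen n) 1 (insub j.-1).

Lemma sE (x : 'I_n) : s x.+1 = coxB_gen x.
Proof. by rewrite /s /= valK. Qed.

Lemma s_ord j : 0 < j <= n -> exists2 x : 'I_n, s j = coxB_gen x & j = x.+1.
Proof.
case: j => // j /andP[_ lt_j]; exists (Ordinal lt_j) => //.
by rewrite -sE.
Qed.

Lemma s_sq j : s j * s j = 1.
Proof.
by rewrite /s; case: insub => [x|] /=; [exact: coxB_gen_sq | exact: mulg1].
Qed.

Lemma s_comm i j : 0 < i -> i.+1 < j <= n -> s j * s i = s i * s j.
Proof.
move=> i0 /andP[ij jn].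
have [|x -> xE] := @s_ord i; first lia.
have [|y -> yE] := @s_ord j; first lia.
by apply: coxB_gen_comm; lia.
Qed.

Lemma s_braid3 i : 0 < i -> i.+1 < n ->
  s i.+1 * s i * s i.+1 = s i * s i.+1 * s i.
Proof.
move=> i0 lt_i.
have [|x -> xE] := @s_ord i; first lia.
have [|y -> yE] := @s_ord i.+1; first lia.
by apply: coxB_gen_braid3; lia.
Qed.

Lemma s_braid4 i : 0 < i -> i.+1 = n ->
  s i.+1 * s i * s i.+1 * s i = s i * s i.+1 * s i * s i.+1.
Proof.
move=> i0 lt_i.
have [|x -> xE] := @s_ord i; first lia.
have [|y -> yE] := @s_ord i.+1; first lia.
by apply: coxB_gen_braid4; lia.
Qed.

(* s_{ji} in the notation of the paper. *)
Definition sdesc j i : coxB n := \prod_(x <- descent j i) s x.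

Lemma descent_rcons j i : i <= j -> descent j i = rcons (descent j i.+1) i.
Proof.
by move=> le_ij; rewrite /descent subSn //= rev_cons subSS.
Qed.

Lemma descent_nil j i : j < i -> descent j i = [::].
Proof. by move=> lt_ji; rewrite /descent (_ : _ - _ = 0)%N //; lia. Qed.

Lemma sdesc_recr j i : i <= j -> sdesc j i = sdesc j i.+1 * s i.
Proof. by move=> le_ij; rewrite /sdesc descent_rcons // big_rcons. Qed.

Lemma sdesc_nil j i : j < i -> sdesc j i = 1.
Proof. by move=> lt_ji; rewrite /sdesc descent_nil // big_nil. Qed.

Lemma sdesc1 j : sdesc j j = s j.
Proof. by rewrite sdesc_recr // sdesc_nil // mul1g. Qed.

Lemma sdesc_ind (P : nat -> Prop) j :
  P j.+1 -> (forall i, i <= j -> P i.+1 -> P i) -> forall i, i <= j.+1 -> P i.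
Proof.
move=> P0 PS i le_i; rewrite -(subKn le_i).
elim: (_ - i)%N => [|m IHm]; first by rewrite subn0.
have [lt_m|le_m] := ltnP m j.+1; last by rewrite (_ : _ - _ = j.+1 - m)%N //; lia.
by apply: PS; rewrite subSS ?leq_subr // -subSn.
Qed.

Lemma sdesc_comm j i k : 0 < k -> k.+1 < i <= j.+1 -> j <= n ->
  sdesc j i * s k = s k * sdesc j i.
Proof.
move=> k0 /andP[ki ij] jn; move: i ij ki; apply: sdesc_ind => [_|i le_i IH ki].
  by rewrite sdesc_nil // mulg1 mul1g.
rewrite sdesc_recr // -mulgA s_comm //; last lia.
by rewrite mulgA IH 1?mulgA //; lia.
Qed.

(** The letter s_k passes the letters of index below k - 1, a length-three braid move turns it into
    s_{k-1}, and this commutes with the rest. The bound k < n excludes the length-four relation. *)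
Lemma sdesc_shift j i k : 0 < i -> i < k <= j -> j <= n -> k < n ->
  sdesc j i * s k = s k.-1 * sdesc j i.
Proof.
move=> i0 /andP[ik kj] jn kn; have ij : i <= j.+1 by lia.
move: i ij i0 ik; apply: sdesc_ind => [|i le_i IH i0 ik]; first lia.
case: k => // k in kj kn IH ik *.
(* Now [k] is the former index minus one; when it equals i, the braid move uses the last two
   letters. *)
have [eik|nik] := eqVneq i k.
  rewrite -{}eik in kj kn IH ik *.
  rewrite (sdesc_recr le_i) sdesc_recr //= -!mulgA (mulgA (s _)) s_braid3 //.
  rewrite !mulgA; congr (_ * _ * _).
  by rewrite sdesc_comm //; lia.
rewrite sdesc_recr // -mulgA -s_comm //; last lia.
by rewrite mulgA IH 1?mulgA //; lia.
Qed.

(** Two equal factors become strictly increasing at the cost of a letter s_{n-1} on the left. The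
    case i = n - 1 is the length-four braid relation. *)
Lemma sdesc_twice i : 0 < i < n ->
  sdesc n i * sdesc n i = s n.-1 * sdesc n i * sdesc n i.+1.
Proof.
move=> /andP[i0 lt_i]; have [m mE] : exists m, (i + m).+1 = n.
  by exists (n - i.+1)%N; lia.
elim: m i i0 lt_i mE => [|m IHm] i i0 lt_i mE.
  have En : i.+1 = n by lia.
  have -> : sdesc n i = s i.+1 * s i by rewrite sdesc_recr 1?ltnW // En sdesc1.
  have -> : n.-1 = i by rewrite -En.
  by rewrite !mulgA s_braid4 // En sdesc1.
have Di : sdesc n i = sdesc n i.+1 * s i by rewrite sdesc_recr // ltnW.
have Di1 : sdesc n i.+1 = sdesc n i.+2 * s i.+1 by rewrite sdesc_recr.
have comm_i : sdesc n i.+2 * s i = s i * sdesc n i.+2.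
  by rewrite sdesc_comm // leqnn; lia.
(* With E = s_{n,i+2} the product is E s_{i+1} s_i E s_{i+1} s_i; commuting s_i with E and one braid
   move give the square of s_{n,i+1} followed by s_i s_{i+1}. *)
rewrite Di {2}Di1 -!mulgA (mulgA (s i)) -comm_i -!mulgA (mulgA (s i)).
rewrite -s_braid3 //; last lia.
rewrite (mulgA (sdesc n i.+2)) mulgA (mulgA (sdesc n i.+2)) -Di1 -mulgA.
rewrite !mulgA IHm //; try lia.
rewrite -[LHS]mulgA -[RHS]mulgA -!(mulgA (s n.-1 * _)); congr (_ * _).
by rewrite mulgA comm_i -mulgA -Di1.
Qed.

(** The part s_{1 i_1} ... s_{m i_m} of a normal word, by recursion on its last factor, where right
    multiplication acts first. *)
Fixpoint type_A_normal m a : Prop :=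
  if m is l.+1 then
    exists b i, [/\ type_A_normal l b, 0 < i <= m.+1 & a = b * sdesc m i]
  else a = 1.

(** Depending on how k compares with the lowest index i of the last factor, s_k commutes with it,
    extends it, cancels its last letter, or becomes s_{k-1} on its left. *)
Lemma type_A_normal_mul m a k : type_A_normal m a -> 0 < k <= m -> m < n ->
  type_A_normal m (a * s k).
Proof.
elim: m a k => [|m IHm] a k; first lia.
case=> b [i [bP iP ->]] kP lt_m.
have [ki|] := ltnP k.+1 i.
  exists (b * s k), i; split=> //; first by apply: IHm => //; lia.
  by rewrite -!mulgA sdesc_comm //; lia.
rewrite leq_eqVlt => /orP[/eqP ik|].
  exists b, k; rewrite -mulgA ik -sdesc_recr; last lia.
  by split=> //; lia.
rewrite ltnS leq_eqVlt => /orP[/eqP ik|ik].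
  exists b, k.+1; rewrite -ik sdesc_recr -?ik; last by lia.
  by rewrite -!mulgA s_sq mulg1 ik; split=> //; lia.
exists (b * s k.-1), i; split=> //; first by apply: IHm => //; lia.
by rewrite -!mulgA sdesc_shift //; lia.
Qed.

(** * Right multiplication of the factors s_{nj} by a generator *)

Definition signs_prod js : coxB n := \prod_(j <- js) sdesc n j.

Lemma signs_prod_rcons js j : signs_prod (rcons js j) = signs_prod js * sdesc n j.
Proof. exact: big_rcons. Qed.

Lemma sorted_rcons js j :
  sorted ltn (rcons js j) = sorted ltn js && all (ltn^~ j) js.
Proof. by rewrite !(sorted_pairwise ltn_trans) pairwise_rcons andbC. Qed.

(** Each factor passed lowers the index by one, and strict increase of [js] keeps it above the
    factors still to be passed. *)
Lemma signs_prod_shift js k : sorted ltn js -> all (fun j => 0 < j < k) js ->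
  0 < k < n -> exists2 k', 0 < k' < n & signs_prod js * s k = s k' * signs_prod js.
Proof.
elim/last_ind: js k => [|js j IH] k.
  by exists k => //; rewrite /signs_prod big_nil mul1g mulg1.
rewrite sorted_rcons all_rcons => /andP[sjs js_j] /andP[jk js_k] kn.
have [||k' k'P jsE] := IH k.-1 sjs.
- apply/allP => x xjs; have := allP js_j x xjs; have := allP js_k x xjs.
  by rewrite /=; lia.
- case/andP: jk => ? ?; lia.
exists k' => //; rewrite signs_prod_rcons -mulgA sdesc_shift //; try lia.
by rewrite !mulgA jsE.
Qed.

(** Either the letter is absorbed, or a letter below s_n leaves on the left, where the type A part
    can take it. The bound M keeps room for the last factor when the recursion changes the earlier
    ones. *)
Lemma signs_prod_mul js M k : sorted ltn js -> all (fun j => 0 < j <= M) js ->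
    M <= n -> 0 < k -> k < M \/ k = n /\ M = n ->
  exists js', [/\ sorted ltn js', all (fun j => 0 < j <= M) js' &
    signs_prod js * s k = signs_prod js' \/
    exists2 k', 0 < k' < n & signs_prod js * s k = s k' * signs_prod js'].
Proof.
elim/last_ind: js M k => [|js j IH] M k.
  move=> _ _ le_M k0 kM; have [lt_k|le_k] := ltnP k n.
    exists [::]; split=> //; right; exists k; first by rewrite k0.
    by rewrite /signs_prod big_nil mulg1 mul1g.
  have kE : k = n by lia.
  have ME : M = n by lia.
  exists [:: k]; split=> //=; first by rewrite k0 ME kE leqnn.
  by left; rewrite /signs_prod big_seq1 big_nil mul1g kE sdesc1.
rewrite sorted_rcons all_rcons => /andP[sjs js_j] /andP[jM jsM] le_M k0 kM.
have js0 : all (fun x => 0 < x < j) js.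
  by apply/allP => x xjs; have := allP js_j x xjs; have := allP jsM x xjs => /=; lia.
rewrite signs_prod_rcons -mulgA.
have [ltkj|] := ltnP k.+1 j.
  have [||||js' [sjs' js'P js'E]] := IH j.-1 k sjs; try lia.
    by apply: sub_all js0 => x /=; lia.
  exists (rcons js' j); split.
  - by rewrite sorted_rcons sjs'; apply: sub_all js'P => x /=; lia.
  - by rewrite all_rcons jM; apply: sub_all js'P => x /=; lia.
  rewrite sdesc_comm //; try lia.
  rewrite mulgA signs_prod_rcons; case: js'E => [->|[k' k'P ->]]; first by left.
  by right; exists k'; rewrite ?mulgA.
(* Here k + 1 = j and the last factor becomes s_{nk}; if the factor before it is also s_{nk}, the
   square is rewritten and s_{n-1} moves out to the left. *)
rewrite leq_eqVlt => /orP[/eqP jE|].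
  rewrite jE -sdesc_recr; last lia.
  have := sjs; have := js0; have := jsM; case/lastP: (js) => [_ _ _|js1 x].
    exists [:: k]; split=> //=; first by rewrite k0; lia.
    by left; rewrite /signs_prod big_nil big_seq1 mul1g.
  rewrite sorted_rcons !all_rcons => /andP[xM js1M] /andP[xj js1_j] /andP[sjs1 js1x].
  have [xk|nxk] := eqVneq x k; last first.
    exists (rcons (rcons js1 x) k); split.
    - rewrite !sorted_rcons sjs1 js1x all_rcons /=.
      have ltxk : x < k by lia.
      by rewrite ltxk; apply: sub_all js1x => y /= /ltn_trans->.
    - by rewrite !all_rcons xM js1M; lia.
    by left; rewrite !signs_prod_rcons.
  have [||k' k'P js1E] := @signs_prod_shift js1 n.-1 sjs1; try lia.
    by apply/allP => y yjs1; have := allP js1x y yjs1; have := allP js1M y yjs1;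
      rewrite /=; lia.
  exists (rcons (rcons js1 x) j); split.
  - rewrite !sorted_rcons sjs1 js1x all_rcons /=.
    have ltxj : x < j by lia.
    by rewrite ltxj; apply: sub_all js1x => y /= /ltn_trans->.
  - by rewrite !all_rcons xM js1M; lia.
  right; exists k' => //; rewrite !signs_prod_rcons xk -mulgA sdesc_twice //; try lia.
  by rewrite !mulgA js1E -jE.
(* Here k = j and the last letter cancels; for k = n the whole factor disappears. *)
rewrite ltnS leq_eqVlt => /orP[/eqP jk|jk].
  have [lt_k|le_k] := ltnP k n; last first.
    exists js; split=> //; left.
    have kE : k = n by lia.
    by rewrite jk kE sdesc1 s_sq mulg1.
  exists (rcons js j.+1); split.
  - by rewrite sorted_rcons sjs; apply: sub_all js_j => y /=; lia.
  - by rewrite all_rcons jsM; lia.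
  left; rewrite signs_prod_rcons jk sdesc_recr; last lia.
  by rewrite -mulgA s_sq mulg1.
(* Here k > j: s_n starts a new factor, and a smaller letter moves left through all factors. *)
have [lt_k|le_k] := ltnP k n; last first.
  have kE : k = n by lia.
  exists (rcons (rcons js j) k); split.
  - rewrite !sorted_rcons sjs js_j all_rcons /= jk.
    by apply: sub_all js_j => y /= /ltn_trans->.
  - by rewrite !all_rcons jM jsM; lia.
  by left; rewrite !signs_prod_rcons -mulgA kE sdesc1.
have [|||k' k'P jsE] := @signs_prod_shift (rcons js j) k; try lia.
- by rewrite sorted_rcons sjs.
- rewrite all_rcons; apply/andP; split; first lia.
  by apply: sub_all js0 => y /=; lia.
exists (rcons js j); split.
- by rewrite sorted_rcons sjs.
- by rewrite all_rcons jM.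
by right; exists k' => //; rewrite mulgA -signs_prod_rcons.
Qed.

Lemma normal_word_exists_prod a : exists b js,
  [/\ type_A_normal n.-1 b, sorted ltn js, all (fun j => 0 < j <= n) js &
     a = b * signs_prod js].
Proof.
elim/coxB_ind: a => [|a x [b [js [bP sjs jsP ->]]]].
  exists 1, [::]; split=> //; last by rewrite /signs_prod big_nil mulg1.
  (* The identity takes i_l = l + 1, so that every factor is empty. *)
  elim: n.-1 => //= m IHm; exists 1, m.+2; split=> //; first lia.
  by rewrite sdesc_nil // mulg1.
have lt_x := ltn_ord x.
have [|||js' [sjs' js'P]] := @signs_prod_mul js n x.+1 sjs jsP; try lia.
rewrite sE => -[jsE|[k' k'P jsE]]; rewrite -mulgA jsE; first by exists b, js'.
exists (b * s k'), js'; split=> //; last by rewrite mulgA.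
by apply: type_A_normal_mul => //; lia.
Qed.

Lemma type_A_normalP m b : type_A_normal m b -> exists i : nat -> nat,
  (forall l, 0 < l <= m -> 0 < i l <= l.+1) /\
  b = \prod_(l <- iota 1 m) sdesc l (i l).
Proof.
elim: m b => [|m IHm] b.
  by move=> /= ->; exists id; rewrite big_nil; split=> // l; lia.
case=> b' [j [/IHm[i [iP ->]] jP ->]].
exists (fun l => if l == m.+1 then j else i l); split=> [l lP|].
  by case: eqP => [->//|nl]; apply: iP; lia.
have -> : iota 1 m.+1 = iota 1 m ++ [:: m.+1] by have := iotaD 1 m 1; rewrite addn1.
rewrite big_cat big_seq1 eqxx; congr (_ * _).
rewrite big_seq [RHS]big_seq; apply: eq_bigr => l; rewrite mem_iota => lP.
by rewrite ifN //; lia.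
Qed.

Lemma coxB_word_nat (w : seq 'I_n) :
  coxB_word w = \prod_(j <- [seq (nat_of_ord x).+1 | x <- w]) s j.
Proof. by rewrite big_map; apply: eq_bigr => x _; rewrite sE. Qed.

Lemma word_of_nat js : all (fun j => 0 < j <= n) js ->
  exists w : seq 'I_n, [seq (nat_of_ord x).+1 | x <- w] = js.
Proof.
elim: js => [|j js IH]; first by exists [::].
case/andP=> jP /IH[w <-]; have [x _ ->] := s_ord jP.
by exists (x :: w).
Qed.

Lemma mem_descent j i x : (x \in descent j i) = (i <= x <= j).
Proof. by rewrite mem_rev mem_iota; lia. Qed.

Lemma normal_word_exists a : exists w, is_normal_word w /\ coxB_word w = a.
Proof.
have [b [js [/type_A_normalP[i [iP ->]] sjs jsP ->]]] := normal_word_exists_prod a.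
have [|w wE] := @word_of_nat (flatten [seq descent l (i l) | l <- iota 1 n.-1]
          ++ flatten [seq descent n j | j <- js]).
  rewrite all_cat; apply/andP; split; apply/allP => x /flatten_mapP[l].
    rewrite mem_iota mem_descent => lP; have := iP l; lia.
  by move/(allP jsP); rewrite mem_descent; lia.
exists w; split; last first.
  by rewrite coxB_word_nat wE big_cat !big_flatten !big_map.
by exists i, js.
Qed.

Lemma normal_formP a : is_normal_word (normal_form a) /\ coxB_word (normal_form a) = a.
Proof.
exact: (@xgetPex _ [::] [set w | is_normal_word w /\ coxB_word w = a]%classic
  (normal_word_exists a)).
Qed.

End NormalWords.

(** * Length and weak order *)

Section WeakOrder.
Context (n : nat).
Implicit Types (a b c : coxB n) (i j k l m p : nat) (js : seq nat).
Local Open Scope group_scope.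

Local Notation len a := (inv_weight (to_perm a)).

(** One-line notation of the inverse: right multiplication by s_j exchanges the entries at positions
    j - 1 and j, and the mirror pair. Out of range, p is its own value. *)
Definition pos a p : nat :=
  oapp (fun x : 'I_(n.*2) => nat_of_ord ((to_perm a)^-1 x)) p (insub p).

Lemma pos_ord a (x : 'I_(n.*2)) : pos a x = (to_perm a)^-1 x.
Proof. by rewrite /pos valK. Qed.

Lemma pos1 p : pos 1 p = p.
Proof. by rewrite /pos to_perm1 invg1; case: insubP => // x _ /= <-; rewrite perm1. Qed.

Lemma pos_mul_s a j p : 0 < j <= n -> p < n.*2 ->
  pos (a * s n j) p = pos a (swap_pos n j.-1 p).
Proof.
move=> jP lt_p; have [x -> ->] := s_ord jP.
rewrite -[p]/(val (Ordinal lt_p)) pos_ord to_permM to_perm_gen invMg signed_swapV.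
by rewrite permM -pos_ord signed_swapE.
Qed.

Lemma len_mul_s a j : 0 < j <= n -> pos a j.-1 < pos a j ->
  len (a * s n j) = len a + 4.
Proof.
move=> jP; have [x -> jE] := s_ord jP; rewrite jE /= => lt_pos.
have lt_x := ltn_ord x.
have px : x < n.*2 by lia.
have qx : x.+1 < n.*2 by lia.
rewrite to_permM to_perm_gen.
apply: (@inv_weight_swapr _ _ _ (Ordinal px) (Ordinal qx)) => //.
  exact: to_perm_signed.
by rewrite -!pos_ord.
Qed.

Lemma pos_mirror a : 0 < n -> pos a n = (n.*2 - (pos a n.-1).+1)%N.
Proof.
move=> n0; have p1 : n.-1 < n.*2 by lia.
have p2 : n < n.*2 by lia.
rewrite -[X in pos a X]/(val (Ordinal p2)) -[n.-1]/(val (Ordinal p1)) !pos_ord.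
have -> : Ordinal p2 = rev_ord (Ordinal p1) by apply/val_inj => /=; lia.
by rewrite (signed_permP _ (signed_permV (to_perm_signed a))).
Qed.

(** The letters s_j ... s_i carry the entry at position j down to position i - 1. All entries it
    passes are smaller, so each letter adds 4 to the weight. *)
Lemma pos_sdesc j i a : 0 < i <= j.+1 -> j <= n ->
    (forall x, i <= x <= j -> pos a x.-1 < pos a j) ->
  len (a * sdesc n j i) = (len a + 4 * size (descent j i))%N /\
  forall x, x < n -> pos (a * sdesc n j i) x =
    if x == i.-1 then pos a j else if i <= x <= j then pos a x.-1 else pos a x.
Proof.
move=> /andP[i0 ij] jn; move: i ij i0; apply: sdesc_ind => [_ _|i le_i IH i0 lt_pos].
  rewrite sdesc_nil // mulg1 descent_nil // muln0 addn0; split=> // x lt_x /=.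
  by case: eqP => [-> //|_]; rewrite ifN //; lia.
have [|x xP|lenE posE] := IH; first by [].
  by apply: lt_pos; lia.
rewrite sdesc_recr // mulgA descent_rcons // size_rcons.
have pos_i : pos (a * sdesc n j i.+1) i = pos a j.
  (* If i = n, the position formula below n does not apply, but then j = n and no letter has been
     used yet. *)
  have [lt_i|le_ni] := ltnP i n; first by rewrite posE //= eqxx.
  have -> : j = i by lia.
  by rewrite sdesc_nil // mulg1.
have pos_i1 : pos (a * sdesc n j i.+1) i.-1 = pos a i.-1.
  rewrite posE; last lia.
  by rewrite ifN ?ifN //=; lia.
split.
  rewrite len_mul_s ?lenE ?pos_i ?pos_i1; [lia | lia |].
  by apply: lt_pos; lia.
move=> x lt_x; rewrite pos_mul_s; [|lia|lia].
case: (x =P i.-1) => [->|nx].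
  by rewrite /swap_pos eqxx (_ : i.-1.+1 = i) //; lia.
case: (x =P i) => [->|nx'].
  rewrite /swap_pos ifN; last lia.
  rewrite ifT; last lia.
  by rewrite pos_i1 ifT //; lia.
have -> : swap_pos n i.-1 x = x by rewrite /swap_pos; do 4![rewrite ifN; last lia].
rewrite posE //= ifN; last lia.
by congr (if _ then _ else _); lia.
Qed.

(** After m factors the first m + 1 positions hold values at most m and the next entry is still in
    place, hence larger than all that s_{m+1,i} moves it past. *)
Lemma len_type_A m (i : nat -> nat) : m < n ->
    (forall l, 0 < l <= m -> 0 < i l <= l.+1) ->
  let b := \prod_(l <- iota 1 m) sdesc n l (i l) in
  [/\ len b = (4 * size (flatten [seq descent l (i l) | l <- iota 1 m]))%N,
      forall x, x <= m -> pos b x <= m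
    & forall x, m < x < n -> pos b x = x].
Proof.
elim: m => [|m IHm] lt_m iP.
  rewrite /= big_nil to_perm1 inv_weight1; split=> // x; rewrite pos1 //.
have [||lenb pos_le pos_id] := IHm; first lia.
  by move=> l lP; apply: iP; lia.
move: lenb pos_le pos_id; set b := \prod_(_ <- _) _ => lenb pos_le pos_id.
have iotaS : iota 1 m.+1 = iota 1 m ++ [:: m.+1] by have := iotaD 1 m 1; rewrite addn1.
have im : 0 < i m.+1 <= m.+2 by apply: iP; lia.
rewrite iotaS big_cat big_seq1 map_cat flatten_cat size_cat /= cats0 -/b.
have pos_m : pos b m.+1 = m.+1 by apply: pos_id; lia.
have [|x xP|lenE posE] := @pos_sdesc m.+1 (i m.+1) b im; first lia.
  by rewrite pos_m ltnS; apply: pos_le; lia.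
split; first by rewrite lenE lenb; lia.
  move=> x le_x; rewrite posE ?pos_m; last lia.
  case: eqP => [//|nx]; case: ifP => xi; first by rewrite ltnW // ltnS pos_le; lia.
  by rewrite ltnW // ltnS pos_le; lia.
move=> x xP; rewrite posE; last lia.
by rewrite ifN ?ifN ?pos_id; lia.
Qed.

(** The factor s_{nj} brings in the entry at position n, the mirror image of a value below n and so
    larger than all it passes. Positions from the last index of [js] on keep values below n; the
    default 0 of [last] serves empty [js]. *)
Lemma len_signs b js : 0 < n -> (forall x, x < n -> pos b x < n) ->
    sorted ltn js -> all (fun j => 0 < j <= n) js ->
  len (b * signs_prod n js) = (len b + 4 * size (flatten [seq descent n j | j <- js]))%N
  /\ forall x, last 0%N js <= x < n -> pos (b * signs_prod n js) x < n.
Proof.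
move=> n0 posb; elim/last_ind: js => [|js j IH].
  rewrite /signs_prod big_nil mulg1 muln0 addn0; split=> // x /andP[_]; exact: posb.
rewrite sorted_rcons all_rcons => /andP[sjs js_j] /andP[jP jsP].
have [lenE lt_pos] := IH sjs jsP.
have lt_last : last 0%N js < j.
  by case/lastP: js js_j {IH sjs jsP lenE lt_pos} => [_|js y]; [case/andP: jP |
    rewrite all_rcons last_rcons => /andP[]].
rewrite signs_prod_rcons mulgA; set a := b * _ in lenE lt_pos *.
have pos_n : n <= pos a n.
  by rewrite pos_mirror //; have := lt_pos n.-1; lia.
have [||x xP|lenE' posE] := @pos_sdesc n j a; try lia.
  by apply: leq_trans pos_n; apply: lt_pos; lia.
rewrite map_rcons flatten_rcons size_cat; split; first by rewrite lenE' lenE; lia.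
move=> x; rewrite last_rcons => xP; rewrite posE; last lia.
rewrite ifN; last lia.
by rewrite ifT; [apply: lt_pos; lia | lia].
Qed.

(** Normal words are reduced: each letter adds 4 to the weight. *)
Lemma inv_weight_coxB_length a : len a = (4 * coxB_length a)%N.
Proof.
rewrite /coxB_length; have [[i [js [iP sjs jsP wE]]] aE] := normal_formP a.
rewrite -[in LHS]aE coxB_word_nat -(size_map (fun x : 'I_n => (nat_of_ord x).+1)) wE.
have [n0|n0] := posnP n.
  have w0 (w : seq 'I_n) : w = [::] by case: w => // x; have := ltn_ord x; lia.
  by rewrite -wE (w0 (normal_form a)) big_nil to_perm1 inv_weight1.
have [|lenA pos_le _] := @len_type_A n.-1 i _ iP; first lia.
rewrite big_cat !big_flatten !big_map size_cat.
have [x lt_x|lenB _] := len_signs n0 _ sjs jsP (b := \prod_(l <- iota 1 n.-1) sdesc n l (i l)).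
  by have := pos_le x; lia.
by rewrite lenB lenA; lia.
Qed.

Lemma coxB_length_eq0 a : coxB_length a = 0%N -> a = 1.
Proof.
have [_ aE] := normal_formP a; move/size0nil => a0.
by rewrite -aE a0 /coxB_word big_nil.
Qed.

Lemma coxB_length_le a b : coxB_length (a * b) <= coxB_length a + coxB_length b.
Proof.
have := inv_weight_le (to_perm b) (to_perm_signed a); rewrite -to_permM.
by rewrite !inv_weight_coxB_length; lia.
Qed.

Lemma perpE a b : perp a b <-> reduced_pair (to_perm a) (to_perm b).
Proof.
rewrite -inv_weight_perp ?to_perm_signed // -to_permM !inv_weight_coxB_length /perp.
lia.
Qed.

(** * Prefixes and joins in the weak order *)

Lemma connect_ind (T : finType) (e : rel T) (r : T -> T -> Prop) :
    (forall x, r x x) -> (forall x y z, e x y -> connect e y z -> r y z -> r x z) ->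
  forall x y, connect e x y -> r x y.
Proof.
move=> r_refl r_step x y /connectP[p]; elim: p x => [|z p IHp] x /=.
  by move=> _ ->.
by case/andP=> exz ep yE; apply: r_step (exz) _ (IHp _ ep yE); apply/connectP; exists p.
Qed.

Lemma invertsxx (g : {perm 'I_(n.*2)}) x : inverts g x x = false.
Proof. by rewrite /inverts !ltnn. Qed.

Lemma inverts_lt (g : {perm 'I_(n.*2)}) (x y : 'I_(n.*2)) : x < y -> inverts g x y = (g y < g x).
Proof.
move=> xy; rewrite /inverts xy /= -leqNgt leq_eqVlt; case: eqP => // /val_inj/perm_inj.
by move=> eyx; rewrite eyx ltnn in xy.
Qed.

(** The left side says that a is a prefix of b. Pulled back along a, the inversions of a^-1 b are
    the symmetric difference of those of a and b. *)
Lemma perp_prefix a b : perp a (a^-1 * b) <->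
  forall x y : 'I_(n.*2), x < y -> inverts (to_perm a) x y -> inverts (to_perm b) x y.
Proof.
have E x y : inverts (to_perm (a^-1 * b)) (to_perm a x) (to_perm a y) =
    inverts (to_perm a) x y (+) inverts (to_perm b) x y.
  by rewrite to_permM to_permV invertsM !permK invertsV !permK.
rewrite perpE; split=> [red x y _ ax|sub x y ax].
  by have := red x y ax; rewrite E ax /= negbK.
rewrite E ax /= negbK; case: (ltngtP x y) => [xy|yx|/val_inj exy].
- exact: sub.
- by rewrite inverts_sym sub // inverts_sym.
- by rewrite exy invertsxx in ax.
Qed.

(** The last two properties of m are conditions on comparisons that hold on each inversion of b1 or
    b2, and so along paths of them. *)
Lemma perp_join a b1 b2 c : perp b1 (b1^-1 * c) -> perp b2 (b2^-1 * c) ->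
    perp a b1 -> perp a b2 ->
  exists m : coxB n, [/\ perp b1 (b1^-1 * m), perp b2 (b2^-1 * m),
    perp m (m^-1 * c) & perp a m].
Proof.
move=> /perp_prefix b1c /perp_prefix b2c /perpE ab1 /perpE ab2.
set B1 := to_perm b1 in b1c ab1; set B2 := to_perm b2 in b2c ab2.
pose e (x y : 'I_(n.*2)) := (x < y) && (inverts B1 x y || inverts B2 x y).
have e_le : forall x y, connect e x y -> x <= y.
  by apply: connect_ind => // x y z /andP[xy _] _ /(leq_trans (ltnW xy)).
have inverts_cotr g (x y z : 'I_(n.*2)) : x < y -> y < z -> inverts g x z ->
    inverts g x y || inverts g y z.
  by move=> xy yz; rewrite !inverts_lt ?(ltn_trans xy yz) //; lia.
(* The complement is transitive by induction along a path with first edge x, t: a point beyond t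
   splits the rest of the path, a point before t splits the first edge. *)
have e_cotr : forall x z, connect e x z -> forall y : 'I_(n.*2), x < y -> y < z ->
    connect e x y || connect e y z.
  apply: connect_ind => [x y|x t z ext tz IH y xy yz]; first by lia.
  case: (ltngtP t y) => [ty|yt|/val_inj <-].
  - case/orP: (IH y ty yz) => [/(connect_trans (connect1 ext))-> //|->].
    by rewrite orbT.
  - have : e x y || e y t.
      rewrite /e xy yt; case/andP: ext => _.
      by case/orP=> /(inverts_cotr _ _ _ _ xy yt)/orP[]->; rewrite ?orbT.
    case/orP=> [/connect1-> //|/connect1/connect_trans/(_ tz)->].
    by rewrite orbT.
  - by rewrite connect1.
have e_rev : forall x y, connect e x y -> connect e (rev_ord y) (rev_ord x).
  apply: connect_ind => // x y z /andP[xy exy] _ /connect_trans; apply.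
  apply: connect1; rewrite /e !inverts_rev ?to_perm_signed // exy andbT /=.
  by have := ltn_ord y; lia.
have [|||x y|M MP ME] := @perm_of_inversions n (fun x y => (x < y) && connect e x y).
- by move=> x y /andP[].
- move=> x y z /andP[xy exy] /andP[yz eyz].
  by rewrite (ltn_trans xy yz) (connect_trans exy eyz).
- by move=> x y z xy yz /andP[_ /e_cotr/(_ y xy yz)]; rewrite xy yz.
- congr (_ && _); first by have := ltn_ord x; have := ltn_ord y => /=; lia.
  by apply/idP/idP => /e_rev; rewrite ?rev_ordK.
have [m mE] := to_perm_surj MP; exists m; split.
- by apply/perp_prefix => x y xy Bxy; rewrite mE ME // xy connect1 // /e xy Bxy.
- by apply/perp_prefix => x y xy Bxy; rewrite mE ME // xy connect1 // /e xy Bxy orbT.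
(* Every edge is an inversion of c, so c also reverses the endpoints of every path. *)
- apply/perp_prefix => x y xy; rewrite mE ME // => /andP[_ exy].
  rewrite inverts_lt // ltn_neqAle (inj_eq val_inj) (inj_eq perm_inj).
  rewrite -val_eqE /= gtn_eqF //=; move: x y exy {xy}.
  apply: connect_ind => // x y z /andP[xy exy] _ /leq_trans; apply.
  by case/orP: exy => [/(b1c _ _ xy)|/(b2c _ _ xy)]; rewrite inverts_lt // => /ltnW.
apply/perpE; rewrite mE => x y.
set g := to_perm a in ab1 ab2 *.
(* As a is perpendicular to b1 and b2, its inverse is increasing on each edge. *)
have e_a : forall u v, connect e u v -> g^-1 u <= g^-1 v.
  apply: connect_ind => // u v t /andP[uv euv] _; apply: leq_trans.
  have g_uv : inverts g (g^-1 u) (g^-1 v) = ~~ (g^-1 u < g^-1 v).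
    by rewrite /inverts !permKV uv addbT.
  apply/ltnW/contraT => nuv; have := ab1 (g^-1 u) (g^-1 v).
  have := ab2 (g^-1 u) (g^-1 v); rewrite g_uv !permKV.
  by case/orP: euv => ->; [move=> _ | move=> + _]; exact.
(* Both inversion relations are symmetric, whereas [ME] speaks of ordered pairs. *)
wlog gxy : x y / g x < g y.
  move=> IH; case: (ltngtP (g x) (g y)) => [|gyx|/val_inj/perm_inj->].
  - exact: IH.
  - by rewrite inverts_sym [inverts M _ _]inverts_sym; apply: IH.
  - by rewrite invertsxx.
rewrite ME // gxy /=; apply: contraL => /e_a; rewrite !permK /inverts gxy addbT negbK.
by rewrite leq_eqVlt => /orP[/eqP/val_inj exy|//]; rewrite exy ltnn in gxy.
Qed.

End WeakOrder.

(** * Groebner-Shirshov bases of decreasing relations *)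

Section LexicographicOrder.
Context (T : eqType) (lt : rel T).
Hypotheses (lt_irr : irreflexive lt) (lt_tr : transitive lt).
Implicit Types u v : seq T.

Lemma lexlt_irr : irreflexive (lexlt lt).
Proof. by elim=> //= x u ->; rewrite lt_irr eqxx. Qed.

Lemma lexlt_tr : transitive (lexlt lt).
Proof.
move=> v u w; elim: u v w => [|x u IH] [|y v] [|z w] //=.
case/orP=> [xy|/andP[/eqP-> uv]] /orP[yz|/andP[/eqP<- vw]].
- by rewrite (lt_tr xy yz).
- by rewrite xy.
- by rewrite yz.
- by rewrite eqxx (IH _ _ uv vw) orbT.
Qed.

Lemma lexlt_total : (forall x y, x != y -> lt x y || lt y x) ->
  forall u v, u != v -> lexlt lt u v || lexlt lt v u.
Proof.
move=> tot; elim=> [|x u IH] [|y v] //=; rewrite eqseq_cons negb_and.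
have [->|nxy _] := eqVneq x y; first by rewrite lt_irr /=; apply: IH.
by case/orP: (tot x y nxy) => ->; rewrite ?orbT.
Qed.

Lemma lexlt_catl s u v : lexlt lt (s ++ u) (s ++ v) = lexlt lt u v.
Proof. by elim: s => //= x s ->; rewrite lt_irr eqxx. Qed.

Lemma lexlt_catr s u v : size u = size v ->
  lexlt lt u v -> lexlt lt (u ++ s) (v ++ s).
Proof.
elim: u v => [|x u IH] [|y v] //= [] /IH{}IH /orP[->//|/andP[-> /IH->]].
by rewrite orbT.
Qed.

(** Among words of one length: induction on the length, then the first letter, then the tail. *)
Lemma lexlt_acc : well_founded lt ->
  forall u, Acc (fun u v => (size u == size v) && lexlt lt u v) u.
Proof.
move=> lt_wf u; move szu: (size u) => m; elim: m u szu => [|m IHm] u.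
  by move/size0nil->; constructor => -[|y v].
case: u => [//|x u [szu]].
elim/(well_founded_ind lt_wf): x u szu => x IHx u szu.
have acc_u := IHm u szu; elim: acc_u szu => {}u _ IHu szu.
constructor=> -[//|y v] /= /andP[/eqP[szv] /orP[yx|/andP[/eqP-> vu]]].
  by apply: IHx => //; rewrite szv.
by apply: IHu; rewrite ?szv ?eqxx.
Qed.

(** The identity as [f] gives deg-lex; f s = N - s gives the ordering of letters, where longer
    normal forms are smaller. *)
Lemma lexlt_wf_size (f : nat -> nat) : well_founded lt ->
  well_founded (fun u v => (f (size u) < f (size v)) ||
                           (size u == size v) && lexlt lt u v).
Proof.
move=> lt_wf u; have [m] := ubnP (f (size u)); elim: m u => [//|m IHm u].
elim: (lexlt_acc lt_wf u) => {}u _ IHu le_um.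
constructor=> v /orP[lt_vu|vu]; first by apply: IHm; lia.
by apply: (IHu v vu); have /andP[/eqP-> _] := vu.
Qed.
End LexicographicOrder.

Section DegLex.
Context (Y : choiceType) (lt : rel Y).
Hypotheses (lt_irr : irreflexive lt) (lt_tr : transitive lt).
Hypothesis lt_tot : forall x y, x != y -> lt x y || lt y x.
Hypothesis lt_wf : well_founded lt.

Lemma deglex_monomial_order : monomial_well_order (deglex lt).
Proof.
split.
- by move=> u; rewrite /deglex ltnn lexlt_irr // andbF.
- move=> v u w /orP[uv|/andP[/eqP uv luv]] /orP[vw|/andP[/eqP vw lvw]];
    rewrite /deglex.
  + by rewrite (ltn_trans uv vw).
  + by rewrite -vw uv.
  + by rewrite uv vw.
  + by rewrite uv vw eqxx (lexlt_tr lt_tr luv lvw) orbT.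
- move=> u v nuv; rewrite /deglex; case: ltngtP => //= _.
  by apply: lexlt_total; rewrite // -fmP.
- move=> a b u v; rewrite /deglex !fmM !size_cat.
  case/orP=> [uv|/andP[/eqP uv luv]]; first by apply/orP; left; lia.
  by rewrite uv eqxx ltnn /= -!catA lexlt_catl // lexlt_catr.
- exact: (wf_inverse_image _ _ _ (@fmonom_val Y) (lexlt_wf_size id lt_wf)).
Qed.
End DegLex.

(** * Compositions of relations between words *)

Section WordRelations.
Local Open Scope ring_scope.
Context (k : fieldType) (Y : choiceType) (lt : rel {fmonom Y}).
Local Notation word := {fmonom Y}.
Local Notation alg := {malg k[word]}.
Local Notation "u ** v" := (mmul u v) (at level 40, left associativity).
Local Open Scope classical_set_scope.

Lemma malgUM (u v : word) : << u >> * << v >> = << u ** v >> :> alg.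
Proof. by rewrite malgM_def fgmulUU mulr1. Qed.

Lemma intersection_composition (A : nzRingType) (x y x' y' a b : A) : x * b = a * x' ->
  (x - y) * b - a * (x' - y') = a * y' - y * b.
Proof. by move=> E; rewrite mulrBl mulrBr E opprB addrC addrA subrK. Qed.

Lemma inclusion_composition (A : nzRingType) (x y x' y' a b : A) : x = a * x' * b ->
  x - y - a * (x' - y') * b = a * y' * b - y.
Proof. by move=> E; rewrite mulrBr mulrBl -E opprB addrC addrA subrK. Qed.

Lemma mulr_sandwich (A : nzRingType) (x a b c y : A) :
  x * (a * b * c) * y = x * a * b * (c * y).
Proof. by rewrite !mulrA. Qed.

Section Ideal.
Context (S : set alg).

Lemma ideal_gen_sub f : S f -> ideal_gen S f.
Proof.
move=> Sf; exists 1%N, (fun _ => 1), (fun _ => 1), (fun _ => f).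
by split=> //; rewrite big_ord1 mul1r mulr1.
Qed.

Lemma ideal_gen0 : ideal_gen S 0.
Proof.
by exists 0%N, (fun _ => 0), (fun _ => 0), (fun _ => 0); rewrite big_ord0; split=> // -[].
Qed.

Lemma ideal_genD f g : ideal_gen S f -> ideal_gen S g -> ideal_gen S (f + g).
Proof.
move=> [m [a [b [s [sS ->]]]]] [m' [a' [b' [s' [s'S ->]]]]].
pose glue (h : 'I_m -> alg) (h' : 'I_m' -> alg) (i : 'I_(m + m')) : alg :=
  match fintype.split i with inl j => h j | inr j => h' j end.
exists (m + m')%N, (glue a a'), (glue b b'), (glue s s'); split.
  by move=> i; rewrite /glue; case: fintype.split.
rewrite big_split_ord; apply: f_equal2; apply: eq_bigr => i _; rewrite /glue.
  by rewrite (unsplitK (inl i)).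
by rewrite (unsplitK (inr i)).
Qed.

Lemma ideal_genM x y f : ideal_gen S f -> ideal_gen S (x * f * y).
Proof.
move=> [m [a [b [s [sS ->]]]]]; exists m, (fun i => x * a i), (fun i => b i * y), s.
split=> //; rewrite big_distrr big_distrl /=; apply: eq_bigr => i _.
exact: mulr_sandwich.
Qed.

Lemma ideal_gen_le (S' : set alg) : S' `<=` ideal_gen S -> ideal_gen S' `<=` ideal_gen S.
Proof.
move=> S'S f [m [a [b [s [sS' ->]]]]]; elim/big_ind: _ => [||i _].
- exact: ideal_gen0.
- exact: ideal_genD.
- exact/ideal_genM/S'S.
Qed.
End Ideal.

Section TrivialModulo.
Context (S : set alg) (w : word).

Lemma trivial_modulo0 : trivial_modulo lt S w 0.
Proof.
exists 0%N, (fun _ => 0), (fun _ => w), (fun _ => w), (fun _ => 0).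
by rewrite big_ord0; split=> // -[].
Qed.

Lemma trivial_moduloD f g : trivial_modulo lt S w f ->
  trivial_modulo lt S w g -> trivial_modulo lt S w (f + g).
Proof.
move=> [m [c [a [b [s [sS ->]]]]]] [m' [c' [a' [b' [s' [s'S ->]]]]]].
pose glue T (h : 'I_m -> T) (h' : 'I_m' -> T) (i : 'I_(m + m')) : T :=
  match fintype.split i with inl j => h j | inr j => h' j end.
exists (m + m')%N, (glue _ c c'), (glue _ a a'), (glue _ b b'), (glue _ s s'); split.
  by move=> i; rewrite /glue; case: fintype.split.
rewrite big_split_ord; apply: f_equal2; apply: eq_bigr => i _; rewrite /glue.
  by rewrite (unsplitK (inl i)).
by rewrite (unsplitK (inr i)).
Qed.

Lemma trivial_moduloN f : trivial_modulo lt S w f -> trivial_modulo lt S w (- f).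
Proof.
move=> [m [c [a [b [s [sS ->]]]]]]; exists m, (fun i => - c i), a, b, s; split=> //.
by rewrite -sumrN; apply: eq_bigr => i _; rewrite scaleNr.
Qed.
End TrivialModulo.

Section DecreasingRelations.
Context (R : set (word * word)).
Hypotheses (lt_irr : irreflexive lt) (lt_tr : transitive lt).
Hypothesis R_lt : forall u v, R (u, v) -> lt v u.

Lemma rel_polysP (f : alg) : @rel_polys k Y lt R f <->
  exists u v, R (u, v) /\ f = << u >> - << v >>.
Proof.
split=> [[u [v [Ruv _ ->]]]|[u [v [Ruv ->]]]]; exists u, v; rewrite R_lt //.
by split=> //; apply: contraTneq (R_lt Ruv) => ->; rewrite lt_irr.
Qed.

Lemma leading_diff (u v : word) : lt v u -> is_leading lt (<< u >> - << v >> : alg) u.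
Proof.
move=> vu; have nuv : (v == u) = false by apply: contraTF vu => /eqP->; rewrite lt_irr.
split; first by rewrite -mcoeff_neq0 mcoeffB !mcoeffU1 eqxx nuv subr0 oner_neq0.
move=> x; rewrite -mcoeff_neq0 mcoeffB !mcoeffU1.
have [->|_] := eqVneq u x; first by left.
have [<-|_] := eqVneq v x; first by right.
by rewrite subr0 eqxx.
Qed.

Lemma leading_uniq (f : alg) u v : is_leading lt f u -> is_leading lt f v -> u = v.
Proof.
move=> [uf ltu] [vf ltv]; case: (ltu v vf) => // vu; case: (ltv u uf) => // uv.
by have := lt_tr vu uv; rewrite lt_irr.
Qed.

Definition joined w (x y : word) : Prop :=
  trivial_modulo lt (@rel_polys k Y lt R) w (<< x >> - << y >>).

Lemma joined_refl w x : joined w x x.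
Proof. by rewrite /joined subrr; apply: trivial_modulo0. Qed.

Lemma joined_sym w x y : joined w x y -> joined w y x.
Proof. by move=> /trivial_moduloN; rewrite opprB. Qed.

Lemma joined_trans w y x z : joined w x y -> joined w y z -> joined w x z.
Proof. by move=> xy yz; have := trivial_moduloD xy yz; rewrite addrA subrK. Qed.

Lemma joined_rel w a b u v : R (u, v) -> lt (a ** u ** b) w ->
  joined w (a ** u ** b) (a ** v ** b).
Proof.
move=> Ruv lt_w; exists 1%N, (fun _ => 1), (fun _ => a), (fun _ => b), (fun _ => << u >> - << v >>).
split=> [_|].
  split; first by apply/rel_polysP; exists u, v.
  by exists u => //; apply/leading_diff/R_lt.
by rewrite big_ord1 scale1r mulrBr mulrBl !malgUM.
Qed.

Lemma GS_basis_rel_polys :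
  (forall u v u' v' a b, R (u, v) -> R (u', v') -> u ** b = a ** u' ->
     (size (u ** b) < size u + size u')%N -> joined (u ** b) (v ** b) (a ** v')) ->
  (forall u v u' v' a b, R (u, v) -> R (u', v') -> u = a ** u' ** b ->
     joined u v (a ** v' ** b)) ->
  GS_basis lt (@rel_polys k Y lt R).
Proof.
move=> inter incl; split=> [f|f g fbar gbar].
  case/rel_polysP => u [v [/R_lt vu ->]]; exists u; first exact: leading_diff.
  rewrite mcoeffB !mcoeffU1 eqxx (_ : (v == u) = false) ?subr0 //.
  by apply: contraTF vu => /eqP->; rewrite lt_irr.
case/rel_polysP => u [v [Ruv ->]] /rel_polysP[u' [v' [Ruv' ->]]].
move=> /(leading_uniq (leading_diff (R_lt Ruv)))<-.
move=> /(leading_uniq (leading_diff (R_lt Ruv')))<-.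
split=> w a b.
  move=> -> uE sz; have := joined_sym (inter _ _ _ _ _ _ Ruv Ruv' uE sz).
  suff -> : (<< u >> - << v >>) * << b >> - << a >> * (<< u' >> - << v' >>) =
    << a ** v' >> - << v ** b >> :> alg by [].
  by rewrite -2!malgUM; apply: intersection_composition; rewrite 2!malgUM uE.
move=> -> uE; have := joined_sym (incl _ _ _ _ _ _ Ruv Ruv' uE).
suff -> : << u >> - << v >> - << a >> * (<< u' >> - << v' >>) * << b >> =
  << a ** v' ** b >> - << v >> :> alg by [].
by rewrite -2!malgUM; apply: inclusion_composition; rewrite 2!malgUM uE.
Qed.
End DecreasingRelations.
End WordRelations.

(** * The positive braid monoid of type B *)

Section BraidMonoid.
Context (n : nat).
Implicit Types (a b c d m t x y z : coxB n).
Local Open Scope group_scope.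

(** Associativity of [perp], with converse [perpVV]: the three lengths add up in abc, and
    subadditivity leaves no slack in either bracketing. *)
Lemma perpV a b c : perp a b -> perp (a * b) c -> perp b c /\ perp a (b * c).
Proof.
rewrite /perp => ab abc; have := coxB_length_le b c.
by have := coxB_length_le a (b * c); rewrite mulgA abc ab; lia.
Qed.

Lemma perpVV a b c : perp b c -> perp a (b * c) -> perp a b /\ perp (a * b) c.
Proof.
rewrite /perp mulgA => bc abc; have := coxB_length_le a b.
by have := coxB_length_le (a * b) c; rewrite abc bc; lia.
Qed.

Lemma coxB_length1 : coxB_length (1 : coxB n) = 0%N.
Proof. by have := inv_weight_coxB_length (1 : coxB n); rewrite to_perm1 inv_weight1; lia. Qed.

Lemma perp1 a : perp a 1.
Proof. by rewrite /perp mulg1 coxB_length1 addn0. Qed.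

Lemma perp_neq1 a b : perp a b -> a != 1 -> a * b != 1.
Proof.
move=> ab; apply: contraNneq => ab1; apply/eqP/coxB_length_eq0.
by move: ab; rewrite /perp ab1 coxB_length1; lia.
Qed.

Lemma ord_lt_wf : well_founded (fun i j : 'I_n => i < j).
Proof.
move=> i; have [m] := ubnP i; elim: m i => [//|m IHm] i le_im.
by constructor=> j lt_ji; apply: IHm; apply: leq_trans lt_ji le_im.
Qed.

Lemma letter_lt_irr : irreflexive (@letter_lt n).
Proof.
move=> a; rewrite /letter_lt ltnn lexlt_irr ?andbF // => i.
exact: ltnn.
Qed.

Lemma letter_lt_tr : transitive (@letter_lt n).
Proof.
move=> b a c; rewrite /letter_lt.
set u := normal_form (val a); set v := normal_form (val b).
set w := normal_form (val c).
case/orP=> [uv|/andP[/eqP uv luv]] /orP[vw|/andP[/eqP vw lvw]].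
- by rewrite (ltn_trans vw uv).
- by rewrite -vw uv.
- by rewrite uv vw.
- rewrite uv vw eqxx (lexlt_tr _ luv lvw) ?orbT // => i j k.
  exact: ltn_trans.
Qed.

Lemma normal_form_inj : injective (@normal_form n).
Proof.
move=> a b ab; have [_ <-] := normal_formP a; have [_ <-] := normal_formP b.
by rewrite ab.
Qed.

Lemma letter_lt_total (a b : letter n) : a != b -> letter_lt a b || letter_lt b a.
Proof.
move=> nab; rewrite /letter_lt; case: ltngtP => //= _.
apply: lexlt_total => [i|i j|]; first exact: ltnn.
  by rewrite -val_eqE /=; case: ltngtP.
by rewrite (inj_eq normal_form_inj) (inj_eq val_inj).
Qed.

Lemma letter_lt_wf : well_founded (@letter_lt n).
Proof.
have [N le_N] := inv_weight_bounded n.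
have size_nf a : size (normal_form a) <= N.
  have := le_N (to_perm a); rewrite inv_weight_coxB_length /coxB_length; lia.
apply: (wf_incl _ _ _ _ (wf_inverse_image _ _ _ (fun a : letter n => normal_form (val a))
  (lexlt_wf_size (fun s => N - s)%N ord_lt_wf))) => a b.
have := size_nf (val a); rewrite /letter_lt => le_a /orP[lt_ab|->]; last exact: orbT.
by rewrite ltn_sub2l // (leq_trans lt_ab).
Qed.

Lemma letter_order : monomial_well_order (deglex (@letter_lt n)).
Proof.
apply: deglex_monomial_order.
- exact: letter_lt_irr.
- exact: letter_lt_tr.
- exact: letter_lt_total.
- exact: letter_lt_wf.
Qed.

Local Notation "u ** v" := (mmul u v) (at level 40, left associativity).
Local Notation word := {fmonom letter n}.
Local Notation lt := (deglex (@letter_lt n)).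
Local Notation rels := (@braidB_rels n `|` @braidB_shift_rels n)%classic.

(* [r 1] is the empty word, so that [braid_relsP] covers both families of
   relations: the first one is the second one with c = 1. *)
Definition r a : word := oapp (@fmu (letter n)) mone (insub a).

Lemma r1 : r 1 = mone.
Proof. by rewrite /r insubF // eqxx. Qed.

Lemma r_letter (a : letter n) : r (val a) = fmu a.
Proof. by rewrite /r valK. Qed.

Definition to_letter a (na : a != 1) : letter n := exist _ a na.

Lemma rE a (na : a != 1) : r a = fmu (to_letter na).
Proof. by rewrite -r_letter. Qed.

Lemma size_r a : size (r a) = (a != 1).
Proof.
have [->|na] := eqVneq a 1; first by rewrite r1 fm1.
by rewrite rE fmU.
Qed.

Lemma r_inj a b u v : a != 1 -> b != 1 -> r a ** u = r b ** v -> a = b /\ u = v.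
Proof.
move=> na nb /(congr1 (@fmonom_val _)); rewrite !fmM (rE na) (rE nb) !fmU /=.
by case=> ab uv; split=> //; apply: val_inj.
Qed.

Lemma braid_relsP u v : rels (u, v) <-> exists a b c,
  [/\ a != 1, b != 1, perp a b /\ perp b c,
     u = r a ** r (b * c) & v = r (a * b) ** r c].
Proof.
split.
  case=> [[a [b [ab [pab abE [-> ->]]]]]|].
    exists (val a), (val b), 1; rewrite mulg1 r1 mulm1 -abE !r_letter.
    by split=> //; [exact: (valP a) | exact: (valP b) | split=> //; exact: perp1].
  case=> [a [b [c [ab [bc [pab pbc abE bcE [-> ->]]]]]]].
  exists (val a), (val b), (val c); rewrite -abE -bcE !r_letter.
  by split=> //; [exact: (valP a) | exact: (valP b)].
case=> a [b [c [na nb [ab bc] -> ->]]].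
have nab := perp_neq1 ab na; have [c1|nc] := eqVneq c 1.
  left; exists (to_letter na), (to_letter nb), (to_letter nab); split=> //.
  by rewrite c1 mulg1 r1 mulm1 !rE.
right; exists (to_letter na), (to_letter nb), (to_letter nc), (to_letter nab).
exists (to_letter (perp_neq1 bc nb)); split=> //.
by rewrite (rE na) (rE nc) (rE nab) (rE (perp_neq1 bc nb)).
Qed.

(** If c = 1 a letter disappears; otherwise the first letter becomes longer, hence smaller. *)
Lemma braid_rels_lt u v : rels (u, v) -> lt v u.
Proof.
case/braid_relsP=> a [b [c [na nb [ab bc] -> ->]]].
have nab := perp_neq1 ab na; have nbc := perp_neq1 bc nb.
rewrite /deglex !fmM !size_cat !size_r na nab nbc.
have [->|nc] //= := eqVneq c 1.
rewrite (rE na) (rE nab) !fmU /= /letter_lt /= -!/(coxB_length _) ab.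
have b0 : 0 < coxB_length b by rewrite lt0n; apply: contraNneq nb => /coxB_length_eq0->.
by rewrite -[X in X < _]addn0 ltn_add2l b0.
Qed.

(** * Joining the two rewrites of an overlap *)

Section Confluence.
Context (k : fieldType) (w : word).
Local Notation joined := (joined k lt rels w).

Let lt_irr : irreflexive lt. Proof. by case: letter_order. Qed.
Let lt_tr : transitive lt. Proof. by case: letter_order. Qed.
Let lt_mul p q u v : lt u v -> lt (p ** u ** q) (p ** v ** q).
Proof. by case: letter_order => _ _ _ + _; apply. Qed.

Lemma joined_step p q a b c : a != 1 -> b != 1 -> perp a b -> perp b c ->
    lt (p ** (r a ** r (b * c)) ** q) w ->
  joined (p ** (r a ** r (b * c)) ** q) (p ** (r (a * b) ** r c) ** q) /\
  lt (p ** (r (a * b) ** r c) ** q) w.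
Proof.
move=> na nb ab bc lt_w.
have abc : rels (r a ** r (b * c), r (a * b) ** r c).
  by apply/braid_relsP; exists a, b, c.
split; first exact: (joined_rel k lt_irr braid_rels_lt abc).
exact/(lt_tr _ lt_w)/lt_mul/braid_rels_lt.
Qed.

(** With d = b^-1 m the second letter splits as d (m^-1 x), and one relation moves d onto the first
    letter. *)
Lemma joined_prefix a b m x : a != 1 -> perp a m -> perp b (b^-1 * m) ->
    perp m (m^-1 * x) -> lt (r (a * b) ** r (b^-1 * x)) w -> a * b != 1 ->
  joined (r (a * b) ** r (b^-1 * x)) (r (a * m) ** r (m^-1 * x)).
Proof.
move=> na am bm mx lt_w nab.
have [d1|nd] := eqVneq (b^-1 * m) 1.
  by rewrite -[m](mulVKg b) d1 mulg1; apply: joined_refl.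
have [_ abd] : perp a b /\ perp (a * b) (b^-1 * m) by apply: perpVV; rewrite ?mulVKg.
have [dx _] : perp (b^-1 * m) (m^-1 * x) /\ perp b (b^-1 * m * (m^-1 * x)).
  by apply: perpV; rewrite ?mulVKg.
have := joined_step (p := mone) (q := mone) nab nd abd dx.
rewrite !mul1m !mulm1 -[b^-1 * m * _]mulgA mulVKg -[a * b * _]mulgA mulVKg.
by case/(_ lt_w).
Qed.

(** Both rewrites move a prefix of the same second letter x onto a; with m the join of the prefixes,
    they continue to r(am) r(m^-1 x). *)
Lemma same_word_joined a b c a' b' c' :
    a != 1 -> b != 1 -> perp a b -> perp b c ->
    a' != 1 -> b' != 1 -> perp a' b' -> perp b' c' ->
    w = r a ** r (b * c) -> w = r a' ** r (b' * c') ->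
  joined (r (a * b) ** r c) (r (a' * b') ** r c').
Proof.
move=> na nb ab bc na' nb' ab' bc' wE wE'.
have [aa'] := r_inj na na' (etrans (esym wE) wE'); rewrite -{}aa' in ab' wE' *.
have nbc := perp_neq1 bc nb; have nbc' := perp_neq1 bc' nb'.
rewrite -[r (b * c)]mulm1 -[r (b' * c')]mulm1 => /(r_inj nbc nbc')[eqx _].
have lt_v : lt (r (a * b) ** r c) w.
  by rewrite wE; apply: braid_rels_lt; apply/braid_relsP; exists a, b, c.
have lt_v' : lt (r (a * b') ** r c') w.
  by rewrite wE'; apply: braid_rels_lt; apply/braid_relsP; exists a, b', c'.
have cE : b^-1 * (b * c) = c by rewrite mulKg.
have cE' : b'^-1 * (b * c) = c' by rewrite eqx mulKg.
have [||m [bm b'm mx am]] := @perp_join n a b b' (b * c) _ _ ab ab'; rewrite ?cE ?cE' //.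
have := joined_prefix na am bm mx; rewrite cE => /(_ lt_v (perp_neq1 ab na)) jm.
have := joined_prefix na am b'm mx; rewrite cE' => /(_ lt_v' (perp_neq1 ab' na)) jm'.
exact: joined_trans jm (joined_sym jm').
Qed.

(** Moving b and moving y are independent; the two words meet at r(ab) r(cy) r(t). *)
Lemma overlap_joined a b c y t : a != 1 -> b != 1 -> perp a b -> perp b c ->
    y != 1 -> perp (b * c) y -> perp y t ->
    w = r a ** r (b * c) ** r (y * t) ->
  joined (r (a * b) ** r c ** r (y * t)) (r a ** (r (b * c * y) ** r t)).
Proof.
move=> na nb ab bc ny xy yt wE.
have nab := perp_neq1 ab na; have nx := perp_neq1 bc nb.
have lt_u : lt (r (a * b) ** r c ** r (y * t)) w.
  rewrite wE -[X in lt (X ** _)]mul1m -[X in lt _ (X ** _)]mul1m; apply: lt_mul.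
  by apply: braid_rels_lt; apply/braid_relsP; exists a, b, c.
have lt_v : lt (r a ** (r (b * c * y) ** r t)) w.
  rewrite wE -[X in lt _ X]mulmA -[X in lt X]mulm1 -[X in lt _ X]mulm1; apply: lt_mul.
  by apply: braid_rels_lt; apply/braid_relsP; exists (b * c), y, t.
have [cy b_cy] := perpV bc xy.
have [j2 lt_p] : joined (r a ** (r (b * c * y) ** r t)) (r (a * b) ** r (c * y) ** r t) /\
    lt (r (a * b) ** r (c * y) ** r t) w.
  have := joined_step (p := mone) (q := r t) na nb ab b_cy.
  by rewrite !mul1m mulgA -mulmA => /(_ lt_v).
apply: joined_trans (joined_sym j2).
(* For c = 1 there is no letter r(c) to move y onto; instead r(ab) r(y) r(t) rewrites to r(ab)
   r(yt). *)
have [c1|nc] := eqVneq c 1; last first.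
  have := joined_step (p := r (a * b)) (q := mone) nc ny cy yt.
  by rewrite !mulm1 !mulmA => /(_ lt_u)[].
rewrite c1 r1 mulm1 mul1g; apply: joined_sym; rewrite c1 mul1g in lt_p.
have [t1|nt] := eqVneq t 1; first by rewrite t1 mulg1 r1 mulm1; apply: joined_refl.
have := joined_step (p := r (a * b)) (q := mone) ny nt yt (perp1 t).
by rewrite mulg1 r1 !mulm1 mulmA => /(_ lt_p)[].
Qed.
End Confluence.

Lemma size_mulw (u v : word) : size (u ** v) = (size u + size v)%N.
Proof. by rewrite fmM size_cat. Qed.

Lemma size0_word (u : word) : size u = 0%N -> u = mone.
Proof. by move/size0nil=> u0; apply: val_inj; rewrite /= u0 fm1. Qed.

Lemma size1_word (u : word) : size u = 1%N -> exists2 a, a != 1 & u = r a.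
Proof.
case: u => -[|a [|b u]] //= _; exists (val a); first exact: (valP a).
by rewrite r_letter fmuE.
Qed.

Lemma braid_GS_basis (k : fieldType) : GS_basis lt (@rel_polys k _ lt rels).
Proof.
have [lt_irr lt_tr _ _ _] := letter_order.
have size_u (a b c : coxB n) : a != 1 -> b != 1 -> perp b c ->
    size (r a ** r (b * c)) = 2.
  by move=> na nb bc; rewrite size_mulw !size_r na (perp_neq1 bc nb).
apply: GS_basis_rel_polys => //; first exact: braid_rels_lt.
  move=> u v u' v' p q /braid_relsP[a [b [c [na nb [ab bc] -> ->]]]].
  case/braid_relsP=> a' [b' [c' [na' nb' [ab' bc'] -> ->]]] E.
  have sz_pq : size (r a ** r (b * c)) + size q = size p + size (r a' ** r (b' * c')).
    by rewrite -!size_mulw E.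
  rewrite (size_mulw (_ ** _)) !size_u // in sz_pq *.
  (* Left-hand words have two letters, so they overlap in both or in one. *)
  case sz_q: (size q) => [|[|m]]; [move=> _ | move=> _ | lia].
    have q1 := size0_word sz_q; have p1 : p = mone by apply: size0_word; lia.
    move: E; rewrite q1 p1 !mulm1 !mul1m => E.
    exact: same_word_joined E.
  have [y ny qE] := size1_word sz_q; have [x nx pE] : exists2 x, x != 1 & p = r x.
    by apply: size1_word; lia.
  rewrite {}qE {}pE in E *; rewrite -mulmA in E; have [xa E'] := r_inj na nx E.
  have [ba E''] := r_inj (perp_neq1 bc nb) na' E'.
  have [yE _] : y = b' * c' /\ mone = mone :> word.
    by apply: r_inj ny (perp_neq1 bc' nb') _; rewrite !mulm1.
  rewrite -xa yE -ba in ab' *.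
  exact: (overlap_joined k na nb ab bc nb' ab' bc' erefl).
move=> u v u' v' p q /braid_relsP[a [b [c [na nb [ab bc] -> ->]]]].
case/braid_relsP=> a' [b' [c' [na' nb' [ab' bc'] -> ->]]] E.
have : size (r a ** r (b * c)) = size p + size (r a' ** r (b' * c')) + size q.
  by rewrite -!size_mulw -E.
rewrite !size_u // => sz_pq.
have q1 : q = mone by apply: size0_word; lia.
have p1 : p = mone by apply: size0_word; lia.
move: E; rewrite q1 p1 !mulm1 !mul1m => E.
exact: same_word_joined E.
Qed.

(** The shift polynomial as a combination of two defining ones; [ab] and [bc] stand for the letters
    of the products. *)
Lemma shift_in_ideal (A : nzRingType) (a b c ab bc : A) :
  ((a * b - ab) * c + - a * (b * c - bc) = a * bc - ab * c)%R.
Proof. by rewrite mulrBl mulNr mulrBr mulrA opprB addrC addrA subrK. Qed.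

Lemma braid_rels_ideal (k : fieldType) :
  ideal_gen (@rel_polys k _ lt rels) = ideal_gen (@rel_polys k _ lt (@braidB_rels n)).
Proof.
have [lt_irr lt_tr _ _ _] := letter_order.
have rels_lt u v : @braidB_rels n (u, v) -> lt v u.
  by move=> uv; apply: braid_rels_lt; left.
apply/seteqP; split; apply: ideal_gen_le => f.
  case/(rel_polysP lt_irr braid_rels_lt)=> u [v [[uv|uv] ->]].
    by apply: ideal_gen_sub; apply/(rel_polysP lt_irr rels_lt); exists u, v.
  case: uv => a [b [c [ab [bc [pab pbc abE bcE [-> ->]]]]]].
  have sub (x y : word) : @braidB_rels n (x, y) ->
      ideal_gen (@rel_polys k _ lt (@braidB_rels n)) (<< x >> - << y >>)%R.
    by move=> xy; apply: ideal_gen_sub; apply/(rel_polysP lt_irr rels_lt); exists x, y.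
  have Iab := sub _ _ (ex_intro _ a (ex_intro _ b (ex_intro _ ab (And3 pab abE erefl)))).
  have Ibc := sub _ _ (ex_intro _ b (ex_intro _ c (ex_intro _ bc (And3 pbc bcE erefl)))).
  have := ideal_genD (ideal_genM 1%R << fmu c >> Iab) (ideal_genM (- << fmu a >>)%R 1%R Ibc).
  rewrite mul1r mulr1 -(malgUM k (fmu a) (fmu b)) -(malgUM k (fmu b) (fmu c)).
  by rewrite shift_in_ideal 2!malgUM.
case/(rel_polysP lt_irr rels_lt)=> u [v [uv ->]].
apply: ideal_gen_sub; apply/(rel_polysP lt_irr braid_rels_lt); exists u, v.
by split=> //; left.
Qed.

End BraidMonoid.

Local Open Scope classical_set_scope.

Theorem theorem3p3 (n : nat) (k : fieldType) (hn : 2 <= n) :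
  GS_basis_of_monoid k (deglex (@letter_lt n))
    (@braidB_rels n) (@braidB_rels n `|` @braidB_shift_rels n).
Proof.
by split; [exact: letter_order | exact: braid_GS_basis | exact: braid_rels_ideal].
Qed.
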